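(* Let $(\mathcal G,(\cdot,\cdot),\dot{\mathfrak h})\in\mathcal D$ (for a given $\nu\ge1$), with root system $\dot R$. For $1\le i\le\nu$ let $d_i\in\mathrm{Der}(\mathcal G)$ be the degree derivation $d_ix=n_ix$ for $x\in\mathcal G^{(n_1,\dots,n_\nu)}$ (these are linearly independent). Let $C=\bigoplus_{i=1}^\nu\mathbb F c_i$ be a $\nu$-dimensional vector space, $D=\bigoplus_{i=1}^\nu\mathbb F d_i$, $\mathcal L=\mathcal G\oplus C\oplus D$ and $\mathcal H=\dot{\mathfrak h}\oplus C\oplus D$. Define an anticommutative product $[\cdot,\cdot]'$ on $\mathcal L$ by $[\mathcal L,C]'=0$, $[D,D]'=0$, $[d_i,x]'=d_ix$ ($x\in\mathcal G$), $[x,y]'=[x,y]+\sum_{i=1}^\nu(d_ix,y)c_i$ ($x,y\in\mathcal G$), and extend $(\cdot,\cdot)$ to a symmetric bilinear form on $\mathcal L$ by $(C,C)=(D,D)=0$, $(c_i,d_j)=\delta_{ij}$, $(C,\mathcal G)=(D,\mathcal G)=0$. Then $(\mathcal L,[\cdot,\cdot]')$ is a Lie algebra, $(\mathcal L,(\cdot,\cdot),\mathcal H)\in\mathcal T$, $\mathcal L$ is tame of nullity $\nu$ and of the same type as $\dot R$, $\mathcal L_c=\mathcal G\oplus C$, $Z(\mathcal L_c)=C$, and $\mathcal L_{cc}\cong\mathcal G$.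
   Context: $\mathbb F$ is a field of characteristic $0$. If $V$ is a finite-dimensional space with a non-degenerate symmetric bilinear form and $\alpha\in V^\star$, $t_\alpha$ denotes the unique element of $V$ with $(t_\alpha,v)=\alpha(v)$ for all $v\in V$. A nonzero subalgebra $\mathcal H$ of a Lie algebra $\mathcal L$ is a (split) toral subalgebra if $\mathcal L=\bigoplus_{\alpha\in\mathcal H^\star}\mathcal L_\alpha$, where $\mathcal L_\alpha=\{x\in\mathcal L:[h,x]=\alpha(h)x\ \forall h\in\mathcal H\}$; its root system is $\{\alpha:\mathcal L_\alpha\neq0\}$. A finite root system is a subset $\Delta$ containing $0$ with $\Delta^\times:=\Delta\setminus\{0\}$ a finite root system in the sense of Bourbaki; $\Delta_{red}=\{0\}\cup\{\alpha\in\Delta:\alpha/2\notin\Delta\}$. The class $\mathcal T$ consists of triples $(\mathcal L,(\cdot,\cdot),\mathcal H)$ with: (T1) $\mathcal L$ is a Lie algebra over $\mathbb F$ with a non-degenerate symmetric invariant bilinear form; (T2) $\mathcal H$ is a finite-dimensional toral subalgebra and $(\cdot,\cdot)|_{\mathcal H\times\mathcal H}$ is non-degenerate; with $R$ the root system, $(\alpha,\beta):=(t_\alpha,t_\beta)$ on $\mathcal H^\star$, $R^\times=\{\alpha\in R:(\alpha,\alpha)\ne0\}$, $R^0=\{\alpha\in R:(\alpha,\alpha)=0\}$: (T3) for each $\delta\in R^0$ there are $x\in\mathcal L_\delta$, $y\in\mathcal L_{-\delta}$ with $[x,y]=t_\delta$, and for each $\alpha\in R^\times$ and each $0\ne x\in\mathcal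 L_\alpha$ there is $y\in\mathcal L_{-\alpha}$ with $[x,y]=t_\alpha$; (T4) $\mathrm{ad}\,x$ is locally nilpotent for $x\in\mathcal L_\alpha$, $\alpha\in R^\times$; (T5) (a) $R^\times$ is not a disjoint union of two nonempty mutually orthogonal subsets, (b) for each $\delta\in R^0$ there is $\alpha\in R^\times$ with $\alpha+\delta\in R$; (T6) $\Lambda=\mathrm{span}_{\mathbb Z}R^0$ is free abelian of finite rank (the nullity). $\mathcal L_c$ is the subalgebra generated by $\mathcal L_\alpha$, $\alpha\in R^\times$; $\mathcal L_{cc}=\mathcal L_c/Z(\mathcal L_c)$; $\mathcal L$ is tame if $C_{\mathcal L}(\mathcal L_c)\subseteq\mathcal L_c$. The type of $\mathcal L$ is the type of the irreducible finite root system obtained as the image of $R$ in $\mathcal V/\mathcal V^0$, where $\mathcal V=\mathbb R\otimes_{\mathbb Q}\mathrm{span}_{\mathbb Q}R$ (after normalizing the form so some $(\alpha,\alpha)=1$) and $\mathcal V^0$ is the radical of the induced form. The class $\mathcal D$ (for a fixed positive integer $\nu$) consists of triples $(\mathcal G,(\cdot,\cdot),\dot{\mathfrak h})$, $\mathcal G$ a Lie algebra, $(\cdot,\cdot)$ a symmetric bilinear form on $\mathcal G$, $\dot{\mathfrak h}$ a subalgebra, with: (D1) the form is non-degenerate and invariant; (D2) $\dot{\mathfrak h}$ is a finite-dimensional toral subalgebra of $\mathcal G$, with root system $\dot R$; (D3) the form on $\dot{\mathfrak h}$ is non-degenerate and is $\mathbb Q$-valued on $\mathrm{span}_{\mathbb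 Q}\{t_{\dot\alpha}:\dot\alpha\in\dot R\}$; transfer it to $\dot{\mathfrak h}^\star$ by $(\dot\alpha,\dot\beta)=(t_{\dot\alpha},t_{\dot\beta})$ and extend to $\dot{\mathcal U}=\mathbb R\otimes_{\mathbb Q}\mathrm{span}_{\mathbb Q}\dot R$; (D4) this form on $\dot{\mathcal U}$ is positive definite and $\dot R$ is an irreducible finite root system in $\dot{\mathcal U}$; (D5) $\mathcal G=\bigoplus_{\sigma\in\mathbb Z^\nu}\mathcal G^\sigma$ is a $\mathbb Z^\nu$-graded Lie algebra; (D6) $\mathcal G_{\dot\alpha}=\bigoplus_\sigma\mathcal G^\sigma_{\dot\alpha}$ with $\mathcal G^\sigma_{\dot\alpha}=\mathcal G^\sigma\cap\mathcal G_{\dot\alpha}$, for each $\dot\alpha\in\dot R$; (D7) $\dot{\mathfrak h}\subseteq\mathcal G^0_0$; (D8) $\mathcal G_0=\sum_{\dot\alpha\in\dot R^\times}[\mathcal G_{\dot\alpha},\mathcal G_{-\dot\alpha}]$; (D9) $\{\sigma:\mathcal G^\sigma\ne0\}$ generates a subgroup of $\mathbb Z^\nu$ of rank $\nu$; (D10) for $\sigma,\tau$ in the support, $(\mathcal G^\sigma,\mathcal G^\tau)=0$ unless $\sigma+\tau=0$; (D11) $\mathcal G^0\cap\mathcal G_{\dot\alpha}\ne0$ for all $\dot\alpha\in\dot R^\times_{red}$; (D12)(a) for $\dot\alpha\in\dot R^\times$, $\sigma\in\mathbb Z^\nu$, $0\ne x\in\mathcal G^\sigma_{\dot\alpha}$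 there is $y\in\mathcal G^{-\sigma}_{-\dot\alpha}$ with $[x,y]=t_{\dot\alpha}$; (b) for $\sigma$ with $\mathcal G^\sigma_0\ne0$ there are $x\in\mathcal G^\sigma_0$, $y\in\mathcal G^{-\sigma}_0$ with $[x,y]=0$ and $(x,y)=1$. *)

(* Defs.v *)
From HB Require Import structures.
From mathcomp Require Import all_boot all_order all_algebra.
Set Implicit Arguments. Unset Strict Implicit. Unset Printing Implicit Defensive.
Import Order.TTheory GRing.Theory Num.Theory.
Local Open Scope ring_scope.

Section Spans.
Variable M : zmodType.

Definition zspan (S : M -> Prop) (v : M) : Prop :=
  exists s : seq (int * M),
    v = \sum_(p <- s) p.2 *~ p.1 /\ (forall p, p \in s -> S p.2).

Definition z_independent k (b : 'I_k -> M) : Prop :=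
  forall z : 'I_k -> int, \sum_i b i *~ z i = 0 -> forall i, z i = 0.

Definition ab_rank (S : M -> Prop) (k : nat) : Prop :=
  (exists b : 'I_k -> M, (forall i, S (b i)) /\ z_independent b) /\
  (forall b : 'I_k.+1 -> M, (forall i, S (b i)) -> ~ z_independent b).

Definition free_abelian_rank (S : M -> Prop) (k : nat) : Prop :=
  exists b : 'I_k -> M, (forall i, S (b i)) /\ z_independent b /\
    (forall v, S v -> exists z : 'I_k -> int, v = \sum_i b i *~ z i).
End Spans.

Section QSpan.
Variable F : fieldType.
Variable V : lmodType F.
Definition qspan (S : V -> Prop) (v : V) : Prop :=
  exists s : seq (rat * V),
    v = \sum_(p <- s) ratr p.1 *: p.2 /\ (forall p, p \in s -> S p.2).
Definition is_rational (a : F) : Prop := exists q : rat, a = ratr q.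
End QSpan.

Section Lie.
Variable F : fieldType.
Variable V : lmodType F.
Variable br : V -> V -> V.
Variable form : V -> V -> F.

Definition is_lie_algebra : Prop :=
  (forall a x y z, br (a *: x + y) z = a *: br x z + br y z) /\
  (forall a x y z, br x (a *: y + z) = a *: br x y + br x z) /\
  (forall x, br x x = 0) /\
  (forall x y z, br x (br y z) + br y (br z x) + br z (br x y) = 0).

Definition is_derivation (d : V -> V) : Prop :=
  (forall a x y, d (a *: x + y) = a *: d x + d y) /\
  (forall x y, d (br x y) = br (d x) y + br x (d y)).

Definition sym_bilinear_form : Prop :=
  (forall a x y z, form (a *: x + y) z = a * form x z + form y z) /\
  (forall x y, form x y = form y x).
Definition invariant_form : Prop := forall x y z, form (br x y) z = form x (br y z).
Definition nondeg_form : Prop := forall x, (forall y, form x y = 0) -> x = 0.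

Definition subspace (P : V -> Prop) : Prop :=
  P 0 /\ (forall a x y, P x -> P y -> P (a *: x + y)).
Definition subalgebra (P : V -> Prop) : Prop :=
  subspace P /\ (forall x y, P x -> P y -> P (br x y)).
Definition gen_subalg (S : V -> Prop) (x : V) : Prop :=
  forall P, subalgebra P -> (forall y, S y -> P y) -> P x.
Definition centralizer (S : V -> Prop) (x : V) : Prop := forall y, S y -> br x y = 0.
Definition center_of (S : V -> Prop) (x : V) : Prop := S x /\ centralizer S x.

(* A finite-dimensional subalgebra H is given by a basis h : 'I_n -> V;
   H^* is identified with 'rV[F]_n via  alpha |-> (alpha(h_i))_i. *)
Section Toral.
Variable n : nat.
Variable h : 'I_n -> V.

Definition hspan (x : V) : Prop := exists c : 'rV[F]_n, x = \sum_i c 0 i *: h i.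
Definition free_fam : Prop := forall c : 'rV[F]_n, \sum_i c 0 i *: h i = 0 -> c = 0.
Definition wspace (a : 'rV[F]_n) (x : V) : Prop := forall i, br (h i) x = a 0 i *: x.
Definition is_root (a : 'rV[F]_n) : Prop := exists x, x != 0 /\ wspace a x.
Definition fd_toral : Prop :=
  (0 < n)%N /\ free_fam /\ subalgebra hspan /\
  forall x, exists s : seq ('rV[F]_n * V),
    x = \sum_(p <- s) p.2 /\ (forall p, p \in s -> wspace p.1 p.2).

Definition gram : 'M[F]_n := \matrix_(i, j) form (h i) (h j).
(* transferred form (alpha, beta) := (t_alpha, t_beta) on H^* *)
Definition rform (a b : 'rV[F]_n) : F := (a *m invmx gram *m b^T) 0 0.
Definition tvec (a : 'rV[F]_n) : V := \sum_i (a *m invmx gram) 0 i *: h i.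

Definition Rx (a : 'rV[F]_n) : Prop := is_root a /\ rform a a != 0.
Definition R0 (a : 'rV[F]_n) : Prop := is_root a /\ rform a a = 0.
Definition Lambda : 'rV[F]_n -> Prop := zspan R0.

Definition Lc : V -> Prop := gen_subalg (fun x => exists a, Rx a /\ wspace a x).

Definition in_T : Prop :=
  [/\ is_lie_algebra /\ sym_bilinear_form /\ invariant_form /\ nondeg_form,
      fd_toral /\ gram \in unitmx,
      (forall d, R0 d -> exists x y, wspace d x /\ wspace (- d) y /\ br x y = tvec d) /\
      (forall a, Rx a -> forall x, wspace a x -> x != 0 ->
          exists y, wspace (- a) y /\ br x y = tvec a),
      (forall a x, Rx a -> wspace a x -> forall y, exists k, iter k (br x) y = 0) /\
      (~ exists P Q : 'rV[F]_n -> Prop,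
          (forall a, Rx a <-> (P a \/ Q a)) /\ (forall a, ~ (P a /\ Q a)) /\
          (exists a, P a) /\ (exists a, Q a) /\
          (forall a b, P a -> Q b -> rform a b = 0)) /\
      (forall d, R0 d -> exists a, Rx a /\ is_root (a + d)) &
      exists k, free_abelian_rank Lambda k ].

Definition nullity (k : nat) : Prop := free_abelian_rank Lambda k.

Definition tame : Prop := forall x, centralizer Lc x -> Lc x.

(* The image of R in V/V^0 (V = R (x)_Q span_Q R, V^0 = radical of the form)
   is isomorphic, as a finite root system, to Rd.  Expressed through the
   Q-structures: a Q-linear map on span_Q R, with kernel span_Q R \cap V^0,
   mapping R onto Rd (its R-linear extension is the isomorphism). *)
Definition same_type (m : nat) (Rd : 'rV[F]_m -> Prop) : Prop :=
  exists f : 'rV[F]_n -> 'rV[F]_m,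
    (forall (q : rat) u v, qspan is_root u -> qspan is_root v ->
        f (ratr q *: u + v) = ratr q *: f u + f v) /\
    (forall u, qspan is_root u -> (f u = 0 <-> forall a, is_root a -> rform u a = 0)) /\
    (forall a, is_root a -> Rd (f a)) /\
    (forall b, Rd b -> exists a, is_root a /\ f a = b).
End Toral.
End Lie.

Section RootSystem.
Variable F : fieldType.
Variable m : nat.
Variable S : 'rV[F]_m -> Prop.
Variable rf : 'rV[F]_m -> 'rV[F]_m -> F.

(* S (containing 0) is an irreducible finite root system in
   R (x)_Q span_Q S, for the (positive definite) form rf, and rf is
   positive definite there.  *)
Definition irr_fin_root_system_posdef : Prop :=
  [/\ S 0,
      (exists s : seq 'rV[F]_m, forall a, S a -> a \in s),
      (forall u, qspan S u -> u != 0 -> exists q : rat, (0 < q)%R /\ rf u u = ratr q),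
      (forall a b, S a -> a != 0 -> S b ->
          S (b - (2 * rf b a / rf a a) *: a) /\
          exists z : int, 2 * rf b a / rf a a = z%:~R) &
      ~ exists P Q : 'rV[F]_m -> Prop,
          (forall a, (S a /\ a != 0) <-> (P a \/ Q a)) /\ (forall a, ~ (P a /\ Q a)) /\
          (exists a, P a) /\ (exists a, Q a) /\
          (forall a b, P a -> Q b -> rf a b = 0) ].
End RootSystem.

Section ClassD.
Variable F : fieldType.
Variable G : lmodType F.
Variable br : G -> G -> G.
Variable form : G -> G -> F.
Variable m : nat.
Variable h : 'I_m -> G.
Variable nu : nat.
Variable gr : 'rV[int]_nu -> G -> Prop.

Definition Rd (a : 'rV[F]_m) : Prop := is_root br h a.
Definition supp (s : 'rV[int]_nu) : Prop := exists x, x != 0 /\ gr s x.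

Definition in_D : Prop :=
  [/\ is_lie_algebra br,
      sym_bilinear_form form /\ invariant_form br form /\ nondeg_form form,
      fd_toral br h,
      gram form h \in unitmx /\
      (forall u v, qspan (fun t => exists2 a, Rd a & t = tvec form h a) u ->
                   qspan (fun t => exists2 a, Rd a & t = tvec form h a) v ->
                   is_rational (form u v)) &
      irr_fin_root_system_posdef Rd (rform form h)] /\
  [/\
      [/\ forall s, subspace (gr s),
          forall s t x y, gr s x -> gr t y -> gr (s + t) (br x y),
          forall x, exists l : seq ('rV[int]_nu * G),
             x = \sum_(p <- l) p.2 /\ (forall p, p \in l -> gr p.1 p.2) &
          forall l : seq ('rV[int]_nu * G), uniq (map fst l) ->
             (forall p, p \in l -> gr p.1 p.2) -> \sum_(p <- l) p.2 = 0 ->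
             forall p, p \in l -> p.2 = 0],
      (forall a x, Rd a -> wspace br h a x -> exists l : seq ('rV[int]_nu * G),
          x = \sum_(p <- l) p.2 /\
          (forall p, p \in l -> gr p.1 p.2 /\ wspace br h a p.2)),
      (forall i, gr 0 (h i) /\ wspace br h 0 (h i)) &
  [/\
      (forall x, wspace br h 0 x -> exists l : seq ('rV[F]_m * G * G),
          x = \sum_(p <- l) br p.1.2 p.2 /\
          (forall p, p \in l -> [/\ Rd p.1.1, p.1.1 != 0,
                 wspace br h p.1.1 p.1.2 & wspace br h (- p.1.1) p.2])),
      ab_rank (zspan supp) nu,
      (forall s t x y, supp s -> supp t -> gr s x -> gr t y -> s + t != 0 ->
          form x y = 0),
      (forall a, Rd a -> a != 0 -> ~ Rd (2^-1 *: a) ->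
          exists x, x != 0 /\ gr 0 x /\ wspace br h a x) &
      (forall a s x, Rd a -> a != 0 -> x != 0 -> gr s x -> wspace br h a x ->
          exists y, gr (- s) y /\ wspace br h (- a) y /\ br x y = tvec form h a) /\
      (forall s, (exists x, x != 0 /\ gr s x /\ wspace br h 0 x) ->
          exists x y, [/\ gr s x /\ wspace br h 0 x, gr (- s) y /\ wspace br h 0 y,
                          br x y = 0 & form x y = 1]) ] ].
End ClassD.

Section Extension.
Variable F : fieldType.
Variable G : lmodType F.
Variable br : G -> G -> G.
Variable form : G -> G -> F.
Variable nu : nat.
Variable d : 'I_nu -> G -> G.

(* elements (x, c, a) stand for x + sum_i c_i c_i + sum_i a_i d_i *)
Definition LT : lmodType F := (G * 'rV[F]_nu * 'rV[F]_nu)%type.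

Definition brL (X Y : LT) : LT :=
  (br X.1.1 Y.1.1 + \sum_i (X.2 0 i *: d i Y.1.1 - Y.2 0 i *: d i X.1.1),
   \row_i form (d i X.1.1) Y.1.1,
   0).

Definition formL (X Y : LT) : F :=
  form X.1.1 Y.1.1 + (X.1.2 *m Y.2^T) 0 0 + (X.2 *m Y.1.2^T) 0 0.

Variable m : nat.
Variable h : 'I_m -> G.

Definition hL (k : 'I_(m + (nu + nu))) : LT :=
  match split k with
  | inl i => (h i, 0, 0)
  | inr j => match split j with
             | inl i => (0, delta_mx 0 i, 0)
             | inr i => (0, 0, delta_mx 0 i)
             end
  end.
End Extension.

(* Main.v *)
(* The roots of L are the pairs (a, s) with G^s_a nonzero, the root space being
   G^s_a itself when (a, s) is nonzero, and the form sees only the finite part a;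
   so the axioms of class T are read off those of class D.  For the nullity one
   needs that every degree s in the support of G occurs already in G_0.  If x is
   nonzero in G^s_a with a reduced, take f in G^0_{-a} (it exists by D11) and
   e in G^0_a with [e, f] = t_a: were [f, x] = 0, then x would be a lowest weight
   vector of positive weight for this sl2, generating an infinite string of roots;
   so [f, x] is a nonzero element of G^s_0.  When a = 2b, the same argument with f
   in G^0_{-b} leads first to G^s_b.  Hence R^0 spans the group generated by the
   support, which has full rank in Z^nu.  Tameness: if (x, c, v) centralizes L_c,
   then ad x = - sum_i v_i d_i on G, and testing this on y in G^s_0, z in G^{-s}_0
   with [y, z] = 0, (y, z) = 1 gives sum_i v_i s_i = 0 for all s in the support. *)
Require Import Defs.
From HB Require Import structures.
From mathcomp Require Import all_boot all_order all_algebra.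
From mathcomp Require Import ring.
From Stdlib Require Import Classical.
Import Order.TTheory GRing.Theory Num.Theory.
Local Open Scope ring_scope.

Set Implicit Arguments.
Unset Strict Implicit.
Unset Printing Implicit Defensive.

(** * Sublattices of full rank *)

Lemma zspan_sub (M : zmodType) (S : M -> Prop) u v :
  zspan S u -> zspan S v -> zspan S (u - v).
Proof.
move=> [s [-> hs]] [t [-> ht]].
exists (s ++ [seq (- p.1, p.2) | p <- t]); split.
  rewrite big_cat big_map /=; congr (_ + _); rewrite -sumrN.
  by apply: eq_bigr => p _; rewrite mulrNz.
move=> p; rewrite mem_cat => /orP[/hs //|/mapP[q /ht hq ->]] //.
Qed.

Lemma zspan_gen (M : zmodType) (S : M -> Prop) u : S u -> zspan S u.
Proof.
move=> Su; exists [:: (1, u)]; split; first by rewrite big_seq1.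
by move=> p; rewrite inE => /eqP ->.
Qed.

(** Serves as the induction principle for [zspan]; closure under subtraction already yields
    negatives, sums and integer multiples. *)
Lemma zspan_min (M : zmodType) (S P : M -> Prop) :
  P 0 -> (forall u v, P u -> P v -> P (u - v)) -> (forall u, S u -> P u) ->
  forall u, zspan S u -> P u.
Proof.
move=> P0 PB SP u [s [-> hs]].
have PN v : P v -> P (- v) by move=> Pv; rewrite -sub0r; apply: PB.
have PD v w : P v -> P w -> P (v + w).
  by move=> Pv Pw; rewrite -[w]opprK; apply: PB => //; apply: PN.
have PMn v k : P v -> P (v *+ k).
  by move=> Pv; elim: k => // k IH; rewrite mulrS; apply: PD.
rewrite big_seq; elim/big_ind: _ => // p /hs/SP Pp.
by case: p.1 => k; [apply: PMn | apply/PN/PMn].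
Qed.

Lemma sum_row_mulz n k (b : 'I_k -> 'rV[int]_n) (z : 'I_k -> int) :
  \sum_i b i *~ z i = (\row_i z i) *m (\matrix_i b i).
Proof.
rewrite mulmx_sum_row; apply: eq_bigr => i _.
by rewrite mxE rowK -scaler_int intz.
Qed.

(** Integer relations among the [b i] form the left kernel of the matrix with these rows, which is
    trivial exactly when the determinant is nonzero. *)
Lemma z_independent_det n (b : 'I_n -> 'rV[int]_n) :
  z_independent b <-> \det (\matrix_i b i) != 0.
Proof.
split=> [ib | /det0P b0 z].
  apply/det0P => -[v v0 vb]; case/negP: v0; apply/eqP/rowP => i; rewrite mxE.
  apply: (ib (v 0)); rewrite sum_row_mulz -[RHS]vb; congr (_ *m _).
  by apply/rowP => j; rewrite mxE.
rewrite sum_row_mulz => zb i.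
have [z0|z0] := eqVneq (\row_i z i) 0; last by case: b0; exists (\row_i z i).
by have := congr1 (fun v : 'rV_n => v 0 i) z0; rewrite !mxE.
Qed.

(** Cramer's rule: in the expansion along row [i] the cofactors do not see that row. *)
Lemma det_replace_row n (B : 'M[int]_n) (v : 'rV_n) i :
  \det (\matrix_(k, j) if k == i then v 0 j else B k j) = (v *m \adj B) 0 i.
Proof.
rewrite (expand_det_row _ i) mxE; apply: eq_bigr => j _.
rewrite !mxE eqxx; congr (_ * (_ * \det _)).
by apply/matrixP => k l; rewrite !mxE eq_sym (negPf (neq_lift _ _)).
Qed.

(* A family in S with minimal nonzero |det| is a basis: by Cramer and Euclidean
   division any element of S not spanned by the family produces, on replacing a
   row, a family of smaller nonzero determinant. *)
Lemma full_rank_sublattice_free n (S : 'rV[int]_n -> Prop)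
    (b : 'I_n -> 'rV[int]_n) :
  S 0 -> (forall u v, S u -> S v -> S (u - v)) ->
  (forall i, S (b i)) -> z_independent b -> free_abelian_rank S n.
Proof.
move=> S0 SB Sb /z_independent_det.
have [k] := ubnP (absz (\det (\matrix_i b i))).
elim: k b Sb => // k IH b Sb ltk db0; set B := \matrix_i b i in ltk db0.
have [gen|] := classic (forall v, S v -> exists z : 'I_n -> int, v = \sum_i b i *~ z i).
  by exists b; split=> //; split=> //; apply/z_independent_det.
move=> /not_all_ex_not[v /(imply_to_and (S v))[Sv nv]].
(* By Cramer [z] holds the coordinates of [v] in the rows of [B], multiplied by $\det B$; [q] holds
   the Euclidean quotients. *)
pose z := v *m \adj B; pose q := \row_i divz (z 0 i) (\det B).
pose v' := v - q *m B.
have Sv' : S v'.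
  apply: (SB) => //; apply: (@zspan_min _ (fun u => exists i, u = b i)) => //.
    by move=> u [i ->].
  exists [seq (q 0 i, b i) | i : 'I_n]; split.
    rewrite mulmx_sum_row big_map big_enum /=; apply: eq_bigr => i _.
    by rewrite rowK -scaler_int intz.
  by move=> p /mapP[i _ ->]; exists i.
have zv' i : (v' *m \adj B) 0 i = modz (z 0 i) (\det B).
  rewrite mulmxBl -mulmxA mul_mx_adj mul_mx_scalar -/z mxE [X in _ + X]mxE.
  rewrite [X in _ - X]mxE [X in _ - _ * X]mxE.
  by rewrite {1}(divz_eq (z 0 i) (\det B)) mulrC addrAC subrr add0r.
(* If all remainders vanish then $\det B\cdot v'=0$, so [v] is an integer combination of the rows,
   against its choice. *)
have [z0|] := eqVneq (v' *m \adj B) 0.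
  case: nv; exists (q 0); rewrite sum_row_mulz -/B.
  have -> : \row_i q 0 i = q by apply/rowP => i; rewrite mxE.
  apply/eqP; rewrite -subr_eq0 -/v'.
  have dv : \det B *: v' = 0.
    by rewrite -mul_mx_scalar -mul_adj_mx mulmxA z0 mul0mx.
  apply/eqP/rowP => i; have /eqP := congr1 (fun u : 'rV_n => u ord0 i) dv.
  by rewrite mxE [X in _ == X]mxE mulf_eq0 (negPf db0) => /eqP ->; rewrite mxE.
case/rV0Pn=> i; rewrite zv' => ri0.
pose b' k' := if k' == i then v' else b k'.
have detb' : \det (\matrix_i b' i) = modz (z 0 i) (\det B).
  rewrite -zv' -det_replace_row; congr (\det _); apply/matrixP => k' j.
  by rewrite !mxE /b'; case: (k' == i); rewrite ?mxE.
apply: (IH b'); rewrite ?detb' //; first by move=> k'; rewrite /b'; case: eqP.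
rewrite ltnS in ltk; apply: leq_trans ltk.
rewrite -ltz_nat !abszE ger0_norm ?modz_ge0 //.
by rewrite ltz_mod.
Qed.

(** * Characteristic zero *)

Section CharZero.
Variable F : fieldType.
Hypothesis hF : [pchar F] =i pred0.

Lemma pchar0_natf_eq0 n : (n%:R == 0 :> F) = (n == 0)%N.
Proof. by move/pcharf0P: hF. Qed.

Lemma pchar0_intr_eq0 (z : int) : (z%:~R == 0 :> F) = (z == 0).
Proof.
case: z => n; first by rewrite -pmulrn pchar0_natf_eq0.
by rewrite NegzE mulrNz !oppr_eq0 -pmulrn pchar0_natf_eq0.
Qed.

Lemma pchar0_intr_inj : injective (fun z : int => z%:~R : F).
Proof.
by move=> y z /eqP; rewrite -subr_eq0 -intrB pchar0_intr_eq0 subr_eq0 => /eqP.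
Qed.

Lemma pchar0_ratr_neq0 (q : rat) : q != 0 -> ratr q != 0 :> F.
Proof.
move=> q0; rewrite /ratr mulf_neq0 ?invr_neq0 //.
  by rewrite pchar0_intr_eq0 numq_eq0.
by rewrite pchar0_intr_eq0 denq_neq0.
Qed.

Lemma pchar0_eq_opp (a : F) : a = - a -> a = 0.
Proof.
move/eqP; rewrite -addr_eq0 -mulr2n -mulr_natl mulf_eq0 pchar0_natf_eq0 /=.
by move/eqP.
Qed.

Lemma map_intr_unitmx n (b : 'I_n -> 'rV[int]_n) :
  z_independent b -> map_mx (intr : int -> F) (\matrix_i b i) \in unitmx.
Proof.
by move/z_independent_det=> b0; rewrite unitmxE unitfE det_map_mx pchar0_intr_eq0.
Qed.

End CharZero.

(** * Weight spaces of a Lie algebra *)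

Section Linear.
Variables (F : fieldType) (V W : lmodType F) (f : V -> W).
Hypothesis fl : forall a x y, f (a *: x + y) = a *: f x + f y.

(** Brackets, forms and derivations are bare functions, so the rules of linearity are derived once
    from the one-line hypothesis. *)
Lemma lin0 : f 0 = 0.
Proof.
have := fl 1 0 0; rewrite !scale1r addr0 => /eqP.
by rewrite -subr_eq0 opprD addrA subrr sub0r oppr_eq0 => /eqP.
Qed.
Lemma linD x y : f (x + y) = f x + f y.
Proof. by rewrite -[x]scale1r fl !scale1r. Qed.
Lemma linZ a x : f (a *: x) = a *: f x.
Proof. by rewrite -[a *: x]addr0 fl lin0 addr0. Qed.
Lemma linN x : f (- x) = - f x.
Proof. by rewrite -scaleN1r linZ scaleN1r. Qed.
Lemma lin_sum I (r : seq I) P E :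
  f (\sum_(i <- r | P i) E i) = \sum_(i <- r | P i) f (E i).
Proof. by elim/big_rec2: _ => [|i y x _ <-]; rewrite ?lin0 ?linD. Qed.
End Linear.

Section LieFacts.
Variables (F : fieldType) (V : lmodType F) (br : V -> V -> V).
Hypothesis Hlie : is_lie_algebra br.

Lemma br_linl z a x y : br (a *: x + y) z = a *: br x z + br y z.
Proof. by case: Hlie. Qed.
Lemma br_linr z a x y : br z (a *: x + y) = a *: br z x + br z y.
Proof. by case: Hlie => _ []. Qed.
Lemma brxx x : br x x = 0.
Proof. by case: Hlie => _ [_ []]. Qed.

Definition br0l x : br 0 x = 0 := lin0 (br_linl x).
Definition br0r x : br x 0 = 0 := lin0 (br_linr x).
Definition brDl x y z : br (x + y) z = br x z + br y z := linD (br_linl z) x y.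
Definition brDr x y z : br z (x + y) = br z x + br z y := linD (br_linr z) x y.
Definition brZl a x z : br (a *: x) z = a *: br x z := linZ (br_linl z) a x.
Definition brZr a x z : br z (a *: x) = a *: br z x := linZ (br_linr z) a x.
Definition brNr x z : br z (- x) = - br z x := linN (br_linr z) x.

Lemma brC x y : br x y = - br y x.
Proof.
apply/eqP; rewrite -addr_eq0; apply/eqP.
by have := brxx (x + y); rewrite brDl !brDr !brxx add0r addr0.
Qed.

Lemma br_leibniz x y z : br x (br y z) = br (br x y) z + br y (br x z).
Proof.
case: Hlie => _ [_ [_ /(_ x y z)]]; rewrite -addrA => /eqP.
rewrite addr_eq0 opprD => /eqP ->.
by rewrite (brC z x) brNr opprK -(brC (br x y)) addrC.
Qed.

Section Weights.
Variables (n : nat) (h : 'I_n -> V).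

Lemma wspace_br a b x y :
  wspace br h a x -> wspace br h b y -> wspace br h (a + b) (br x y).
Proof.
by move=> hx hy i; rewrite br_leibniz hx hy brZl brZr mxE scalerDl.
Qed.

Lemma wspace_iter a b x y k :
  wspace br h a x -> wspace br h b y -> wspace br h (b + a *+ k) (iter k (br x) y).
Proof.
move=> hx hy; elim: k => [|k IH]; first by rewrite mulr0n addr0.
by rewrite mulrS addrCA iterS; exact: (wspace_br hx IH).
Qed.

Variable form : V -> V -> F.

Lemma tvecE a b y : wspace br h b y -> br (tvec form h a) y = rform form h a b *: y.
Proof.
move=> hy; rewrite /tvec (lin_sum (br_linl y)) /rform mxE scaler_suml.
by apply: eq_bigr => i _; rewrite brZl hy scalerA [b^T _ _]mxE.
Qed.

Lemma rformNl a b : rform form h (- a) b = - rform form h a b.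
Proof. by rewrite /rform !mulNmx mxE. Qed.
Lemma rformMnr a b k : rform form h a (b *+ k) = rform form h a b *+ k.
Proof. by rewrite /rform -scaler_nat linearZ /= -scalemxAr mxE mulr_natl. Qed.
Lemma rformZl c a b : rform form h (c *: a) b = c * rform form h a b.
Proof. by rewrite /rform -!scalemxAl mxE. Qed.

End Weights.
End LieFacts.

(** * Algebras in the class D *)

Section ClassD.
Variables (F : fieldType) (hF : [pchar F] =i pred0).
Variables (G : lmodType F) (br : G -> G -> G) (form : G -> G -> F).
Variables (m : nat) (h : 'I_m -> G) (nu : nat) (gr : 'rV[int]_nu -> G -> Prop).
Hypothesis HD : in_D br form h gr.

Local Notation ws := (wspace br h).
Local Notation rf := (rform form h).
Local Notation tv := (tvec form h).
Local Notation root := (Rd br h).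

Lemma D_lie : is_lie_algebra br. Proof. by case: HD => -[]. Qed.
Let Hlie := D_lie.

Lemma form_linl z a x y : form (a *: x + y) z = a * form x z + form y z.
Proof. by case: HD => -[_ [[]]]. Qed.
Lemma formC x y : form x y = form y x.
Proof. by case: HD => -[_ [[]]]. Qed.
Lemma form_linr z a x y : form z (a *: x + y) = a * form z x + form z y.
Proof. by rewrite !(formC z) form_linl. Qed.
Lemma form_inv x y z : form (br x y) z = form x (br y z).
Proof. by case: HD => -[_ [_ [+ _]]]. Qed.
Lemma form_nondeg x : (forall y, form x y = 0) -> x = 0.
Proof. by case: HD => -[_ [_ [_ +]]] _ _ _ _; apply. Qed.

(** The scalars are read as the regular module [F^o], so that the generic linearity lemmas apply to
    the form. *)
Let fll z : forall a x y, (form (a *: x + y) z : F^o) = a *: (form x z : F^o) + form y z :=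
  form_linl z.
Let flr z : forall a x y, (form z (a *: x + y) : F^o) = a *: (form z x : F^o) + form z y :=
  form_linr z.
Definition form0l x : form 0 x = 0 := lin0 (fll x).
Definition form0r x : form x 0 = 0 := lin0 (flr x).
Definition formDl x y z : form (x + y) z = form x z + form y z := linD (fll z) x y.
Definition formDr x y z : form z (x + y) = form z x + form z y := linD (flr z) x y.
Definition formZl a x z : form (a *: x) z = a * form x z := linZ (fll z) a x.
Definition formZr a x z : form z (a *: x) = a * form z x := linZ (flr z) a x.
Definition formNl x z : form (- x) z = - form x z := linN (fll z) x.
Definition formNr x z : form z (- x) = - form z x := linN (flr z) x.

Lemma gram_unit : gram form h \in unitmx.
Proof. by case: HD => -[_ _ _ []]. Qed.

Lemma D_toral : fd_toral br h. Proof. by case: HD => -[]. Qed.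

Lemma gr0 s : gr s 0.
Proof. by case: HD => _ [[+ _ _ _] _ _ _] => /(_ s) []. Qed.
Lemma grZD s a x y : gr s x -> gr s y -> gr s (a *: x + y).
Proof. by case: HD => _ [[+ _ _ _] _ _ _] => /(_ s) [_]; apply. Qed.
Lemma grD s x y : gr s x -> gr s y -> gr s (x + y).
Proof. by move=> hx hy; rewrite -[x]scale1r; apply: grZD. Qed.
Lemma grZ s a x : gr s x -> gr s (a *: x).
Proof. by move=> hx; rewrite -[a *: x]addr0; apply: grZD => //; apply: gr0. Qed.
Lemma grN s x : gr s x -> gr s (- x).
Proof. by rewrite -scaleN1r; apply: grZ. Qed.
Lemma gr_br s t x y : gr s x -> gr t y -> gr (s + t) (br x y).
Proof. by case: HD => _ [[_ + _ _] _ _ _]; apply. Qed.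
Lemma gr_h i : gr 0 (h i). Proof. by case: HD => _ [_ _ /(_ i) [] ]. Qed.
Lemma ws_h i : ws 0 (h i). Proof. by case: HD => _ [_ _ /(_ i) [] ]. Qed.

(** * Bihomogeneous decompositions *)

Lemma sum_by_fst (l : seq ('rV[int]_nu * G)) :
  \sum_(p <- l) p.2 = \sum_(s <- undup (map fst l)) \sum_(p <- l | p.1 == s) p.2.
Proof.
rewrite [RHS](exchange_big_dep xpredT) //=; apply: eq_big_seq => p pl.
rewrite [RHS]big_mkcond (bigD1_seq p.1) ?undup_uniq ?mem_undup ?map_f //= eqxx.
by rewrite big1 ?addr0 // => t; rewrite eq_sym => /negPf ->.
Qed.

(** Directness of the grading is stated for lists with distinct degrees, so the terms are first
    collected degree by degree. *)
Lemma gr_comp (l : seq ('rV[int]_nu * G)) s :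
  (forall p, p \in l -> gr p.1 p.2) -> \sum_(p <- l) p.2 = 0 ->
  \sum_(p <- l | p.1 == s) p.2 = 0.
Proof.
move=> hl sl0; have [_ [[_ _ _ uni] _ _ _]] := HD.
pose C t := \sum_(p <- l | p.1 == t) p.2.
have [sl|sNl] := boolP (s \in map fst l); last first.
  rewrite big_seq_cond big1 // => p /andP[pl /eqP ps].
  by case/negP: sNl; apply/mapP; exists p.
pose l' := [seq (t, C t) | t <- undup (map fst l)].
suff H p : p \in l' -> p.2 = 0.
  apply: (H (s, C s)); apply/mapP; exists s => //; by rewrite mem_undup.
apply: uni p.
- by rewrite -map_comp (eq_map (g := id)) // map_id undup_uniq.
- move=> _ /mapP[t _ ->] /=; rewrite /C big_seq_cond.
  elim/big_ind: _ => [||p /andP[pl /eqP <-]]; [exact: gr0 | exact: grD | exact: hl].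
- by rewrite big_map -sum_by_fst.
Qed.

Lemma bihom_decomp x : exists l : seq ('rV[int]_nu * G),
  x = \sum_(p <- l) p.2 /\
  (forall p, p \in l -> gr p.1 p.2 /\ exists2 a, root a & ws a p.2).
Proof.
have [_ [_ [_ /(_ x)[l [-> hl]]]]] := D_toral.
have [_ [_ D6 _ _]] := HD.
elim: l hl => [|[a y] l IH] hl; first by exists [::]; rewrite !big_nil.
have [|l1 [E1 hl1]] := IH; first by move=> p pl; apply: hl; rewrite inE pl orbT.
have wy : ws a y by apply: (hl (a, y)); rewrite inE eqxx.
(* Zero components are dropped first, because [D6] applies only to weights that are roots. *)
rewrite big_cons E1 /=; have [->|y0] := eqVneq y 0.
  by exists l1; rewrite add0r.
have ra : root a by exists y.
have [l2 [-> hl2]] := D6 a y ra wy.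
exists (l2 ++ l1); rewrite big_cat; split=> // p; rewrite mem_cat => /orP[/hl2[]|/hl1 //].
by split=> //; exists a.
Qed.

(** Reduces additive statements to nonzero vectors homogeneous for both the weights and the
    degree. *)
Lemma bihom_ind (P : G -> Prop) :
  P 0 -> (forall x y, P x -> P y -> P (x + y)) ->
  (forall a s x, root a -> gr s x -> ws a x -> x != 0 -> P x) -> forall x, P x.
Proof.
move=> P0 PD Ph x; have [l [-> hl]] := bihom_decomp x.
rewrite big_seq; elim/big_ind: _ => // p /hl[gp [a ra wa]].
by have [->|p0] := eqVneq p.2 0 => //; apply: (Ph a p.1).
Qed.

Lemma gr_bihom s x : gr s x -> x != 0 ->
  exists a y, [/\ y != 0, gr s y & ws a y].
Proof.
move=> gx /eqP x0; apply: NNPP => none; apply: x0.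
have [l [Ex hl]] := bihom_decomp x.
(* Entering [x] with a minus sign makes a zero sum; its part of degree [s] writes [x] through
   components of degree [s]. *)
have /(gr_comp s) : \sum_(p <- (s, - x) :: l) p.2 = 0.
  by rewrite big_cons -Ex /= addNr.
rewrite big_cons /= eqxx => E.
have := E _; rewrite big_seq_cond big1 => [|p /andP[/hl[gp [a _ wa]] /eqP ps]].
  rewrite addr0 => H; apply: oppr_inj; rewrite oppr0; apply: H => p.
  by rewrite inE => /orP[/eqP -> /=|/hl[]//]; apply: grN.
apply/eqP/negPn/negP => p0; apply: none.
by exists a, p.2; split=> //; rewrite -ps.
Qed.

Lemma ws_bihom a : root a -> exists s y, [/\ y != 0, gr s y & ws a y].
Proof.
move=> ra; have [x [x0 wx]] := ra.
have [_ [_ /(_ a x ra wx)[l [Ex hl]] _ _]] := HD.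
apply: NNPP => none; case/eqP: x0; rewrite Ex big_seq big1 // => p /hl[gp wp].
by apply/eqP/negPn/negP => p0; apply: none; exists p.1, p.2.
Qed.

(** Applying $d_i-b_i$ to [x] multiplies its component of degree $s$ by $s_i-b_i$, so every nonzero
    component has degree [b]; in characteristic 0 this leaves a single integral degree. *)
Lemma gr_eigen a x (d : 'I_nu -> G -> G) (b : 'rV[F]_nu) :
  (forall i c x y, d i (c *: x + y) = c *: d i x + d i y) ->
  (forall i s x, gr s x -> d i x = (s 0 i)%:~R *: x) ->
  root a -> ws a x -> x != 0 -> (forall i, d i x = b 0 i *: x) ->
  exists2 s, gr s x & b = map_mx intr s.
Proof.
move=> dl dd ra wx x0 dx.
have [_ [_ /(_ a x ra wx)[l [Ex hl]] _ _]] := HD.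
pose C s := \sum_(p <- l | p.1 == s) p.2.
have Cb s : C s != 0 -> b = map_mx intr s.
  move=> Cs0; apply/rowP => i; rewrite mxE; apply/eqP; rewrite eq_sym -subr_eq0.
  suff : ((s 0 i)%:~R - b 0 i) *: C s == 0 by rewrite scaler_eq0 (negPf Cs0) orbF.
  pose l' := [seq (p.1, ((p.1 0 i)%:~R - b 0 i) *: p.2) | p : 'rV[int]_nu * G <- l].
  have -> : ((s 0 i)%:~R - b 0 i) *: C s = \sum_(p <- l' | p.1 == s) p.2.
    by rewrite big_map scaler_sumr; apply: eq_bigr => p /eqP /= ->.
  rewrite gr_comp // => [_ /mapP[p /hl[gp _] ->]|] /=; first exact: grZ.
  rewrite big_map /= -[RHS](subrr (d i x)) {2}dx {1 2}Ex (lin_sum (dl i)) scaler_sumr -sumrB.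
  by rewrite !big_seq; apply: eq_bigr => p /hl[gp _]; rewrite scalerBl (dd _ _ _ gp).
have Cgr s : gr s (C s).
  rewrite /C big_seq_cond; elim/big_ind: _ => [||p /andP[/hl[gp _] /eqP <-]] //.
    exact: gr0.
  exact: grD.
have [s Cs0] : exists s, C s != 0.
  apply: NNPP => none; case/negP: x0; rewrite Ex sum_by_fst big1 // => s _.
  by apply/eqP/negPn/negP => Cs; apply: none; exists s.
exists s; last exact: Cb.
rewrite Ex sum_by_fst; elim/big_ind: _ => [||t _]; [exact: gr0 | exact: grD |].
rewrite -/(C t); have [->|Ct0] := eqVneq (C t) 0; first exact: gr0.
suff -> : s = t by [].
apply/rowP => i; have /rowP/(_ i) : map_mx intr s = map_mx intr t :> 'rV[F]_nu.
  by rewrite -(Cb s Cs0) -(Cb t Ct0).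
by rewrite !mxE => /(pchar0_intr_inj hF).
Qed.

(** * The finite root system *)

Let rootsys : irr_fin_root_system_posdef root rf.
Proof. by case: HD => -[]. Qed.

(** Positive definiteness makes the value a positive rational, which stays nonzero in characteristic
    0. *)
Lemma rf_qspan_neq0 u : qspan root u -> u != 0 -> rf u u != 0.
Proof.
move=> qu u0; have [_ _ /(_ u qu u0)[q [q0 ->]] _ _] := rootsys.
by apply: pchar0_ratr_neq0 => //; rewrite gt_eqF.
Qed.

Lemma rf_root_neq0 a : root a -> a != 0 -> rf a a != 0.
Proof.
move=> ra; apply: rf_qspan_neq0; exists [:: (1, a)]; split.
  by rewrite big_seq1 (ratr_nat F 1) scale1r.
by move=> p; rewrite inE => /eqP ->.
Qed.

Lemma rootN a : root a -> root (- a).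
Proof.
have [->|a0] := eqVneq a 0; first by rewrite oppr0.
move=> ra; have [_ _ _ refl _] := rootsys.
(* The reflection in [a] sends [a] to $a-2a$. *)
have [+ _] := refl a a ra a0 ra.
by rewrite mulfK ?rf_root_neq0 // scaler_nat mulr2n opprD addrA subrr sub0r.
Qed.

(** The Cartan integer of $a/4$ against [a] would be $1/2$. Consequently, if $a/2$ is a root, then
    it is reduced. *)
Lemma root_quarter a : root a -> a != 0 -> ~ root (2^-1 *: (2^-1 *: a)).
Proof.
move=> ra a0 rq; have [_ _ _ refl _] := rootsys.
have [_ [z]] := refl a _ ra a0 rq.
have n2 : 2 != 0 :> F by rewrite pchar0_natf_eq0.
rewrite !rformZl mulVKf // mulfK ?rf_root_neq0 // => /(congr1 ( *%R 2)).
rewrite divff // -[X in X = _]/(1%:~R) -[2]/(2%:~R) -intrM.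
by move/(pchar0_intr_inj hF)/(congr1 (odd \o absz)); rewrite /= abszM oddM.
Qed.

(** The elements $b+ka$ are distinct in characteristic 0, while there are finitely many roots. *)
Lemma no_infinite_string a b : a != 0 -> ~ (forall k, root (b + a *+ k)).
Proof.
move=> a0 rab; have [_ [s hs] _ _ _] := rootsys.
have := @uniq_leq_size _ [seq b + a *+ k | k <- iota 0 (size s).+1] s.
rewrite size_map size_iota ltnn => H; suff: false by []; apply: H.
  rewrite map_inj_uniq ?iota_uniq // => i j /addrI/eqP.
  rewrite -!scaler_nat -subr_eq0 -scalerBl scaler_eq0 (negPf a0) orbF subr_eq0.
  by rewrite !pmulrn => /eqP/(pchar0_intr_inj hF) [].
by move=> _ /mapP[k _ ->]; apply: hs.
Qed.

(** By [D8] the zero weight space is spanned by brackets of opposite root vectors, so nonzero root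
    vectors generate the algebra; splitting both factors by degree makes them homogeneous. *)
Lemma nonzero_root_ind (P : G -> Prop) :
  P 0 -> (forall x y, P x -> P y -> P (x + y)) ->
  (forall a s x, root a -> a != 0 -> gr s x -> ws a x -> P x) ->
  (forall a s t x y, root a -> a != 0 -> gr s x -> ws a x -> gr t y -> ws (- a) y ->
     P x -> P y -> P (br x y)) ->
  forall x, P x.
Proof.
move=> P0 PD Pr Pbr; have [_ [_ D6 _ [D8 _ _ _ _]]] := HD.
apply: bihom_ind => // a s x ra gx wx _.
have [a0|a0] := eqVneq a 0; last exact: (Pr a s).
rewrite a0 in wx; have [l [-> hl]] := D8 x wx.
rewrite big_seq; elim/big_ind: _ => // p /hl[rb b0 wy wz].
have [ly [Ey hy]] := D6 _ _ rb wy.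
have [lz [Ez hz]] := D6 _ _ (rootN rb) wz.
rewrite Ey (lin_sum (br_linl Hlie _)) big_seq; elim/big_ind: _ => // q /hy[gq wq].
rewrite Ez (lin_sum (br_linr Hlie _)) big_seq; elim/big_ind: _ => // r /hz[gr' wr].
apply: (Pbr p.1.1 q.1 r.1) => //; first exact: (Pr p.1.1 q.1).
by apply: (Pr (- p.1.1) r.1); rewrite ?oppr_eq0 //; apply: rootN.
Qed.

(** By the Jacobi identity [x] commutes with everything; then $a_i(x,y)=([x,h_i],y)=0$ on root
    vectors and $(x,[y,z])=([x,y],z)=0$ on brackets, so [x] lies in the radical of the form. *)
Lemma center_trivial x :
  (forall a s y, root a -> a != 0 -> gr s y -> ws a y -> br x y = 0) -> x = 0.
Proof.
move=> cx; have c y : br x y = 0.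
  elim/nonzero_root_ind: y => [|y z cy cz|a s y|a s t y z _ _ _ _ _ _ cy cz].
  - by rewrite br0r.
  - by rewrite brDr // cy cz addr0.
  - exact: cx.
  by rewrite br_leibniz // cy cz br0l // br0r // addr0.
apply: form_nondeg; elim/nonzero_root_ind => [|y z cy cz|a s y ra a0 gy wy|].
- by rewrite form0r.
- by rewrite formDr cy cz addr0.
- have /rV0Pn[i ai] := a0.
  apply/eqP; rewrite -(mulrI_eq0 _ (mulfI ai)) -formZr -wy -form_inv.
  by rewrite c form0l.
by move=> a s t y z *; rewrite -form_inv c form0l.
Qed.

(** * Toral pairs and lowering of weights *)

Lemma form_tvec i a : form (h i) (tv a) = a 0 i.
Proof.
rewrite /tvec (lin_sum (flr (h i))) -[in RHS](mulmxKV gram_unit a) mxE.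
by apply: eq_bigr => j _; rewrite formZr [gram _ _ _ _]mxE formC.
Qed.

(** For $a_i\ne0$: $a_i(x,y)=([h_i,x],y)=(h_i,t_a)=a_i$. *)
Lemma form_eq1 a x y : a != 0 -> ws a x -> br x y = tv a -> form x y = 1.
Proof.
move=> /rV0Pn[i ai] wx xy; apply: (mulfI ai).
by rewrite mulr1 -formZl -wx form_inv xy form_tvec.
Qed.

Lemma toral_pair a s x : root a -> a != 0 -> x != 0 -> gr s x -> ws a x ->
  exists y, [/\ gr (- s) y, ws (- a) y & br x y = tv a].
Proof.
case: HD => _ [_ _ _ [_ _ _ _ [D12 _]]] ra a0 x0 gx wx.
by have [y [? []]] := D12 a s x ra a0 x0 gx wx; exists y.
Qed.

Lemma zero_weight_pair s x : x != 0 -> gr s x -> ws 0 x ->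
  exists y z, [/\ gr s y, ws 0 y, gr (- s) z, ws 0 z & br y z = 0 /\ form y z = 1].
Proof.
case: HD => _ [_ _ _ [_ _ _ _ [_ D12]]] x0 gx wx.
have [|y [z [[? ?] [? ?] ? ?]]] := D12 s; first by exists x.
by exists y, z.
Qed.

(* The sl2-argument: a vector of weight ja (j > 0) killed by f would be a lowest
   weight vector generating an infinite string of roots. *)
Lemma lowering_neq0 a j e f y : a != 0 -> rf a a != 0 -> ws a e -> ws (- a) f ->
  br f e = tv (- a) -> ws (a *+ j.+1) y -> y != 0 -> br f y != 0.
Proof.
move=> a0 q0 we wf fe wy y0; apply/eqP => fy.
have fk k : exists2 c : nat, (0 < c)%N &
    br f (iter k.+1 (br e) y) = - (rf a a * c%:R) *: iter k (br e) y.
  elim: k => [|k [c c0 IH]].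
    exists j.+1 => //=; rewrite br_leibniz // fe fy br0r // addr0.
    by rewrite (tvecE Hlie _ _ wy) rformNl rformMnr mulr_natr.
  (* Moving [f] past one more [e] contributes $t_{-a}$ acting on a vector of weight $(j+1+k+1)a$. *)
  exists (j.+1 + k.+1 + c)%N; first by rewrite addn_gt0 c0 orbT.
  rewrite iterS br_leibniz // fe IH brZr // -iterS.
  have wk := wspace_iter Hlie k.+1 we wy.
  rewrite (tvecE Hlie _ _ wk) rformNl -mulrnDr rformMnr -scalerDl; congr (_ *: _).
  by rewrite natrD mulrDr opprD !mulr_natr.
apply: (@no_infinite_string a (a *+ j.+1) a0) => k.
exists (iter k (br e) y); split; last exact: wspace_iter.
elim: k => // k IH; apply/eqP => k0; have [c c0] := fk k.
rewrite k0 br0r // => /esym/eqP; rewrite scaler_eq0 (negPf IH) oppr_eq0 mulf_eq0.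
by rewrite (negPf q0) pchar0_natf_eq0 // orbF; case: c c0.
Qed.

Lemma reduced_lowering a j s y :
  root a -> a != 0 -> ~ root (2^-1 *: a) -> gr s y -> ws (a *+ j.+1) y -> y != 0 ->
  exists x, [/\ x != 0, gr s x & ws (a *+ j) x].
Proof.
move=> ra a0 ha gy wy y0.
have [_ [_ _ _ [_ _ _ D11 _]]] := HD.
have na0 : - a != 0 by rewrite oppr_eq0.
have [|f [f0 [gf wf]]] := D11 _ (rootN ra) na0.
  (* Roots are closed under negation, so $-a$ is reduced too and has a root vector of degree 0. *)
  by rewrite scalerN => /rootN; rewrite opprK.
have [e [ge + fe]] := toral_pair (rootN ra) na0 f0 gf wf.
rewrite opprK => we.
exists (br f y); split.
- exact: (lowering_neq0 a0 (rf_root_neq0 ra a0) we wf fe wy y0).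
- by rewrite -[s]add0r; apply: gr_br.
- by have := wspace_br Hlie wf wy; rewrite mulrS addKr.
Qed.

Lemma supp_zero_weight s : supp gr s -> exists x, [/\ x != 0, gr s x & ws 0 x].
Proof.
move=> [x [x0 gx]]; have [a [y [y0 gy wy]]] := gr_bihom gx x0.
have [a0|a0] := eqVneq a 0; first by exists y; rewrite -a0.
have ra : root a by exists y.
have [rh|nrh] := classic (root (2^-1 *: a)); last first.
  exact: (@reduced_lowering a 0 s y ra a0 nrh gy wy y0).
have n2 : 2 != 0 :> F by rewrite pchar0_natf_eq0.
have h0 : 2^-1 *: a != 0 by rewrite scaler_eq0 invr_eq0 (negPf n2).
(* With $b=a/2$ reduced, [y] has weight $2b$ and is lowered twice. *)
have [||z [z0 gz wz]] :=
  @reduced_lowering (2^-1 *: a) 1 s y rh h0 (root_quarter ra a0) gy => //.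
  by rewrite -scaler_nat scalerA divff // scale1r.
exact: (@reduced_lowering _ 0 s z rh h0 (root_quarter ra a0) gz wz z0).
Qed.

(** As [x] is not central, $[x,y]\ne0$ for some [y] in a nonzero root space; this exhibits [s] as a
    difference of two degrees and, for [x] of weight 0, both occur in the same root space. *)
Lemma zero_weight_supp_diff s x : x != 0 -> gr s x ->
  exists a t y z, [/\ root a, a != 0, y != 0 /\ gr t y /\ ws a y &
    z != 0 /\ gr (s + t) z /\ (ws 0 x -> ws a z)].
Proof.
move=> /eqP x0 gx; apply: NNPP => none; apply: x0.
apply: center_trivial => a t y ra a0 gy wy; apply/eqP/negPn/negP => xy0.
apply: none; exists a, t, y, (br x y); split=> //.
  split=> //; apply: contraNneq xy0 => ->; rewrite br0r //.
split=> //; split=> [|wx]; first exact: gr_br.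
by rewrite -[a]add0r; apply: wspace_br.
Qed.

Lemma supp_basis : exists b : 'I_nu -> 'rV[int]_nu,
  (forall i, zspan (supp gr) (b i)) /\ z_independent b.
Proof. by case: HD => _ [_ _ _ [_ [? _] _ _ _]]. Qed.

(** The relation extends to the span of the support, which contains $\nu$ vectors whose matrix is
    invertible over [F]. *)
Lemma supp_separates (v : 'rV[F]_nu) :
  (forall s, supp gr s -> \sum_i v 0 i * (s 0 i)%:~R = 0) -> v = 0.
Proof.
move=> vs; have [b [Sb /(map_intr_unitmx hF) ub]] := supp_basis.
pose P (s : 'rV[int]_nu) := \sum_i v 0 i * (s 0 i)%:~R = 0.
have Pb i : P (b i).
  apply: (@zspan_min _ (supp gr) P) => // [|s t ps pt].
    by apply: big1 => k _; rewrite mxE mulr0.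
  rewrite /P; under eq_bigr => k _ do rewrite !mxE intrB mulrBr.
  by move: ps pt; rewrite sumrB /P => -> ->; rewrite subrr.
have E : map_mx intr (\matrix_i b i) *m v^T = 0.
  apply/colP => i; rewrite !mxE -[RHS](Pb i).
  by apply: eq_bigr => k _; rewrite !mxE mulrC.
by rewrite -[v]trmxK -[v^T](mulKmx ub) E mulmx0 trmx0.
Qed.

End ClassD.

(** * The extension by the degree derivations *)

Section Extension.
Variables (F : fieldType) (hF : [pchar F] =i pred0).
Variables (G : lmodType F) (br : G -> G -> G) (form : G -> G -> F).
Variables (m : nat) (h : 'I_m -> G) (nu : nat) (gr : 'rV[int]_nu -> G -> Prop).
Hypothesis HD : in_D br form h gr.
Variable d : 'I_nu -> G -> G.
Hypothesis d_lin : forall i a x y, d i (a *: x + y) = a *: d i x + d i y.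
Hypothesis d_deg : forall i s x, gr s x -> d i x = (s 0 i)%:~R *: x.

Let Hlie := D_lie HD.

Local Notation ws := (wspace br h).
Local Notation rf := (rform form h).
Local Notation tv := (tvec form h).
Local Notation root := (Rd br h).

(** * Degree derivations and their skewness for the form *)

Lemma d_h i j : d i (h j) = 0.
Proof. by rewrite (d_deg _ (gr_h HD j)) mxE scale0r. Qed.

Lemma d_derivation i : is_derivation br (d i).
Proof.
split=> // x y; elim/(bihom_ind HD): x => [|x x' IH IH'|a s x _ gx _ _].
- by rewrite (lin0 (d_lin i)) !(br0l Hlie) (lin0 (d_lin i)) addr0.
- by rewrite (linD (d_lin i)) !(brDl Hlie) (linD (d_lin i)) IH IH' addrACA.
elim/(bihom_ind HD): y => [|y y' IH IH'|b t y _ gy _ _].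
- by rewrite (lin0 (d_lin i)) !(br0r Hlie) (lin0 (d_lin i)) addr0.
- by rewrite (linD (d_lin i)) !(brDr Hlie) (linD (d_lin i)) IH IH' addrACA.
rewrite (d_deg _ (gr_br HD gx gy)) (d_deg _ gx) (d_deg _ gy) (brZl Hlie) (brZr Hlie).
by rewrite -scalerDl mxE intrD.
Qed.

Lemma form_d i x y : form (d i x) y = - form x (d i y).
Proof.
elim/(bihom_ind HD): x => [|x x' IH IH'|a s x _ gx _ x0].
- by rewrite (lin0 (d_lin i)) !(form0l HD) oppr0.
- by rewrite (linD (d_lin i)) !(formDl HD) IH IH' opprD.
elim/(bihom_ind HD): y => [|y y' IH IH'|b t y _ gy _ y0].
- by rewrite (lin0 (d_lin i)) !(form0r HD) oppr0.
- by rewrite (linD (d_lin i)) !(formDr HD) IH IH' opprD.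
rewrite (d_deg _ gx) (d_deg _ gy) (formZl HD) (formZr HD) -mulNr -intrN.
(* For opposite degrees the two eigenvalues are opposite; otherwise both sides vanish by [D10]. *)
have [st|st] := eqVneq (s + t) 0.
  by congr (_ %:~R * _); rewrite (eqP (_ : s == - t)) ?mxE // -addr_eq0 st.
have [_ [_ _ _ [_ _ D10 _ _]]] := HD.
by rewrite (D10 s t) ?mulr0 //; [exists x | exists y].
Qed.

(** The action on $\mathcal G$ of the general element $\sum_i v_id_i$ of $D$. *)
Definition dsum (v : 'rV[F]_nu) (x : G) : G := \sum_i v 0 i *: d i x.

Lemma dsum_lin v a x y : dsum v (a *: x + y) = a *: dsum v x + dsum v y.
Proof.
rewrite /dsum scaler_sumr -big_split; apply: eq_bigr => i _.
by rewrite d_lin scalerDr !scalerA mulrC.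
Qed.

Lemma dsum_linl x a u v : dsum (a *: u + v) x = a *: dsum u x + dsum v x.
Proof.
rewrite /dsum scaler_sumr -big_split; apply: eq_bigr => i _.
by rewrite !mxE scalerDl scalerA.
Qed.

Lemma dsum0 x : dsum 0 x = 0. Proof. exact: lin0 (dsum_linl x). Qed.

Lemma dsum_delta i x : dsum (delta_mx 0 i) x = d i x.
Proof.
rewrite /dsum (bigD1 i) //= big1 => [|j ji]; rewrite mxE eqxx /=.
  by rewrite eqxx scale1r addr0.
by rewrite (negPf ji) scale0r.
Qed.

Lemma dsum_br v x y : dsum v (br x y) = br (dsum v x) y + br x (dsum v y).
Proof.
rewrite /dsum (lin_sum (br_linl Hlie _)) (lin_sum (br_linr Hlie _)) -big_split.
apply: eq_bigr => i _; have [_ ->] := d_derivation i.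
by rewrite (brZl Hlie) (brZr Hlie) scalerDr.
Qed.

Lemma form_suml I (r : seq I) P E y :
  form (\sum_(i <- r | P i) E i) y = \sum_(i <- r | P i) form (E i) y.
Proof. by elim/big_rec2: _ => [|i a b _ <-]; rewrite ?(form0l HD) ?(formDl HD). Qed.

Lemma form_dsum v x y : form (dsum v x) y = - form x (dsum v y).
Proof.
rewrite [in RHS](formC HD) !form_suml -sumrN; apply: eq_bigr => i _.
by rewrite !(formZl HD) form_d (formC HD (d i y)) mulrN.
Qed.

Lemma dsum_comm u v x : dsum u (dsum v x) = dsum v (dsum u x).
Proof.
elim/(bihom_ind HD): x => [|x y IHx IHy|a s x _ gx _ _].
- by rewrite !(lin0 (dsum_lin _)).
- by rewrite !(linD (dsum_lin _)) IHx IHy.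
have dx w : dsum w x = (\sum_i w 0 i * (s 0 i)%:~R) *: x.
  rewrite /dsum scaler_suml; apply: eq_bigr => i _.
  by rewrite (d_deg _ gx) scalerA.
by rewrite !dx !(linZ (dsum_lin _)) !dx !scalerA mulrC.
Qed.

Lemma d_comm i v x : d i (dsum v x) = dsum v (d i x).
Proof. by rewrite -!(dsum_delta i) dsum_comm. Qed.

Lemma form_dxx i x : form (d i x) x = 0.
Proof. by apply: (pchar0_eq_opp hF); rewrite {1}form_d (formC HD). Qed.

Lemma dsum_eq0 v : (forall x, dsum v x = 0) -> v = 0.
Proof.
move=> v0; apply: (supp_separates hF HD) => s [x [x0 gx]].
apply/eqP; suff : (\sum_i v 0 i * (s 0 i)%:~R) *: x == 0.
  by rewrite scaler_eq0 (negPf x0) orbF.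
rewrite scaler_suml -[X in _ == X](v0 x); apply/eqP/eq_bigr => i _.
by rewrite (d_deg _ gx) scalerA.
Qed.

(** * The Lie algebra L and its invariant form *)

Local Notation L := (LT G nu).
Local Notation bL := (brL br form d).
Local Notation fL := (@formL F G form nu).
Local Notation H := (@hL F G nu m h).

Definition inG (x : G) : L := (x, 0, 0).

Lemma brLE X Y : bL X Y =
  (br X.1.1 Y.1.1 + (dsum X.2 Y.1.1 - dsum Y.2 X.1.1),
   \row_i form (d i X.1.1) Y.1.1, 0).
Proof. by rewrite /brL /dsum sumrB. Qed.

Lemma LT_eq (X Y : L) : X.1.1 = Y.1.1 -> X.1.2 = Y.1.2 -> X.2 = Y.2 -> X = Y.
Proof. by move: X Y => [[x c] u] [[y c'] v] /= -> -> ->. Qed.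

Lemma brL_lie : is_lie_algebra bL.
Proof.
split; [|split; [|split]].
- move=> a X Y Z; rewrite !brLE; apply: LT_eq => /=; last by rewrite scaler0 addr0.
  + rewrite (br_linl Hlie) dsum_lin dsum_linl !scalerDr scalerN opprD.
    by rewrite [X in _ + X = _]addrACA [LHS]addrACA.
  + by apply/rowP => i; rewrite !mxE d_lin (form_linl HD).
- move=> a X Y Z; rewrite !brLE; apply: LT_eq => /=; last by rewrite scaler0 addr0.
  + rewrite (br_linr Hlie) dsum_lin dsum_linl !scalerDr scalerN opprD.
    by rewrite [X in _ + X = _]addrACA [LHS]addrACA.
  + by apply/rowP => i; rewrite !mxE (form_linr HD).
- move=> X; rewrite brLE; apply: LT_eq => //=; first by rewrite (brxx Hlie) subrr addr0.
  by apply/rowP => i; rewrite !mxE form_dxx.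
move=> [[x c] u] [[y c'] v] [[z c''] w]; rewrite !brLE /= !dsum0 !subr0.
apply: LT_eq => /=; last by rewrite !addr0.
- rewrite !(brDr Hlie) !(brNr Hlie) !(linD (dsum_lin _)) !(linN (dsum_lin _)).
  rewrite !dsum_br !(brC Hlie (dsum _ _)) (dsum_comm u v) (dsum_comm w u) (dsum_comm v w).
  have [_ [_ [_ J]]] := Hlie; rewrite -[RHS](J x y z) !addrA.
  (* Terms 1, 8 and 15 form the Jacobi sum of $\mathcal G$; the other eighteen cancel in pairs. *)
  rewrite +%R.[ACl ((1*8*15)*(2*11)*(19*3)*(16*4)*(5*10)*(6*14)*(20*7)*(9*18)*
                    (12*17)*(13*21))].
  by rewrite !subrr !addr0.
apply/rowP => i; rewrite !mxE !(formDr HD) !(formNr HD).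
(* The 2-cocycle identity for the $c_i$-component, from invariance and skewness of the derivation
   $d_i$. *)
have E : form (d i x) (br y z) + form (d i y) (br z x) + form (d i z) (br x y) = 0.
  rewrite -(form_inv HD (d i x)) (formC HD _ z) (formC HD (d i y)) (form_inv HD z).
  by rewrite form_d (proj2 (d_derivation i)) (formDr HD); ring.
(* Two commuting skew maps give a symmetric pairing, so the terms involving $D$ cancel. *)
have E2 t y' z' : form (d i y') (dsum t z') = form (d i z') (dsum t y').
  by rewrite (formC HD) form_dsum [RHS]form_d d_comm.
rewrite (E2 u z) (E2 v x) (E2 w y) -[RHS]E; ring.
Qed.

Lemma mulmx_trE k (u v : 'rV[F]_k) : (u *m v^T) 0 0 = \sum_i u 0 i * v 0 i.
Proof. by rewrite mxE; apply: eq_bigr => i _; rewrite [v^T _ _]mxE. Qed.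

Lemma mulmx_tr_deltar k (u : 'rV[F]_k) i : (u *m (delta_mx 0 i : 'rV[F]_k)^T) 0 0 = u 0 i.
Proof.
rewrite mulmx_trE (bigD1 i) //= big1 => [|j ji]; rewrite mxE eqxx /=.
  by rewrite eqxx mulr1 addr0.
by rewrite (negPf ji) mulr0.
Qed.

Lemma mulmx_trC k (u v : 'rV[F]_k) : (u *m v^T) 0 0 = (v *m u^T) 0 0.
Proof. by rewrite !mulmx_trE; apply: eq_bigr => i _; rewrite mulrC. Qed.

(** The pairing of the $C$-part of $[x,y]'$ with the element [v] of $D$, needed for invariance. *)
Lemma row_form_dsum x y v :
  ((\row_i form (d i x) y) *m v^T) 0 0 = form (dsum v x) y.
Proof.
rewrite mulmx_trE form_suml; apply: eq_bigr => i _.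
by rewrite mxE (formZl HD) mulrC.
Qed.

Lemma formL_sym : sym_bilinear_form fL.
Proof.
split=> [a X Y Z|X Y]; rewrite /formL.
  rewrite /= (form_linl HD) !mulmxDl -!scalemxAl ![(_ + _ : 'M__) 0 0]mxE.
  by rewrite ![(_ *: _ : 'M__) 0 0]mxE; ring.
by rewrite (formC HD) (mulmx_trC X.1.2) (mulmx_trC X.2) addrAC.
Qed.

Lemma formL_inv : invariant_form bL fL.
Proof.
move=> [[x c] u] [[y c'] v] [[z c''] w]; rewrite /formL !brLE /=.
rewrite trmx0 mul0mx mulmx0 (mulmx_trC u) !row_form_dsum mxE addr0.
rewrite !(formDl HD) !(formDr HD) !(formNl HD) !(formNr HD) (form_inv HD).
by rewrite (form_dsum v x) (form_dsum w x) addr0; ring.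
Qed.

Lemma formL_nondeg : nondeg_form fL.
Proof.
move=> [[x c] u] X0; apply: LT_eq => /=.
- apply: (form_nondeg HD) => y; rewrite -[RHS](X0 (inG y)) /formL /=.
  by rewrite trmx0 !mulmx0 !mxE !addr0.
- apply/rowP => i; rewrite [RHS]mxE -[RHS](X0 (0, 0, delta_mx 0 i)) /formL /=.
  by rewrite (form0r HD) mulmx_tr_deltar trmx0 mulmx0 mxE add0r addr0.
apply/rowP => i; rewrite [RHS]mxE -[RHS](X0 (0, delta_mx 0 i, 0)) /formL /=.
by rewrite (form0r HD) mulmx_tr_deltar trmx0 mulmx0 mxE !add0r.
Qed.

(** * The basis of H and the roots of L *)

Lemma hL_h i : H (lshift _ i) = inG (h i).
Proof. by rewrite /hL (unsplitK (inl i)). Qed.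
Lemma hL_c i : H (rshift m (lshift nu i)) = (0, delta_mx 0 i, 0).
Proof. by rewrite /hL (unsplitK (inr _)) (unsplitK (inl i)). Qed.
Lemma hL_d i : H (rshift m (rshift nu i)) = (0, 0, delta_mx 0 i).
Proof. by rewrite /hL (unsplitK (inr _)) (unsplitK (inr i)). Qed.

Lemma forall_hL (P : 'I_(m + (nu + nu)) -> Prop) :
  (forall i, P (lshift _ i)) -> (forall i, P (rshift m (lshift nu i))) ->
  (forall i, P (rshift m (rshift nu i))) -> forall k, P k.
Proof.
move=> Ph Pc Pd k; case: (splitP k) => [i|j] E.
  by rewrite (_ : k = lshift _ i) //; apply: val_inj.
case: (splitP j) E => i Ej E.
  by rewrite (_ : k = rshift m (lshift nu i)) //; apply: val_inj; rewrite /= E Ej.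
by rewrite (_ : k = rshift m (rshift nu i)) //; apply: val_inj; rewrite /= E Ej.
Qed.

Lemma br_hL_h i X : bL (inG (h i)) X = inG (br (h i) X.1.1).
Proof.
rewrite brLE /= dsum0; apply: LT_eq => //=.
  by rewrite /dsum big1 ?subrr ?addr0 // => j _; rewrite d_h scaler0.
by apply/rowP => j; rewrite !mxE d_h (form0l HD).
Qed.

Lemma br_hL_c c X : bL (0, c, 0) X = 0.
Proof.
rewrite brLE /= dsum0 (lin0 (dsum_lin _)); apply: LT_eq => //=.
  by rewrite (br0l Hlie) subrr addr0.
by apply/rowP => j; rewrite !mxE (lin0 (d_lin j)) (form0l HD).
Qed.

Lemma br_hL_d v X : bL (0, 0, v) X = inG (dsum v X.1.1).
Proof.
rewrite brLE /= (lin0 (dsum_lin _)); apply: LT_eq => //=.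
  by rewrite (br0l Hlie) subr0 add0r.
by apply/rowP => j; rewrite !mxE (lin0 (d_lin j)) (form0l HD).
Qed.

(** The middle block is 0 because $C$ is central; the last block records the eigenvalues of the
    $d_i$. *)
Definition wtL (a : 'rV[F]_m) (s : 'rV[int]_nu) : 'rV[F]_(m + (nu + nu)) :=
  row_mx a (row_mx 0 (map_mx intr s)).

Lemma wtL_h a s i : wtL a s 0 (lshift _ i) = a 0 i.
Proof. by rewrite row_mxEl. Qed.
Lemma wtL_c a s i : wtL a s 0 (rshift m (lshift nu i)) = 0.
Proof. by rewrite row_mxEr row_mxEl mxE. Qed.
Lemma wtL_d a s i : wtL a s 0 (rshift m (rshift nu i)) = (s 0 i)%:~R.
Proof. by rewrite !row_mxEr mxE. Qed.

Lemma wtLN a s : wtL (- a) (- s) = - wtL a s.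
Proof.
apply/rowP; apply: forall_hL => i; rewrite [RHS]mxE ?wtL_h ?wtL_c ?wtL_d ?mxE //.
  by rewrite oppr0.
by rewrite intrN.
Qed.
Lemma wtLD a b s t : wtL a s + wtL b t = wtL (a + b) (s + t).
Proof.
apply/rowP; apply: forall_hL => i; rewrite [LHS]mxE ?wtL_h ?wtL_c ?wtL_d ?mxE //.
  by rewrite addr0.
by rewrite intrD.
Qed.
Lemma wtL0 : wtL 0 0 = 0.
Proof. by apply/rowP; apply: forall_hL => i; rewrite ?wtL_h ?wtL_c ?wtL_d !mxE. Qed.

Lemma wtL_inj a b s t : wtL a s = wtL b t -> a = b /\ s = t.
Proof.
move=> E; split; apply/rowP => i.
  by rewrite -(wtL_h a s) E wtL_h.
by apply: (pchar0_intr_inj hF); rewrite -(wtL_d a s) E wtL_d.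
Qed.

Lemma wspace_inG a s x : gr s x -> ws a x -> wspace bL H (wtL a s) (inG x).
Proof.
have inGZ c y : inG (c *: y) = c *: inG y.
  by apply: LT_eq => //=; rewrite scaler0.
move=> gx wx; apply: forall_hL => i.
- by rewrite hL_h br_hL_h wtL_h wx inGZ.
- by rewrite hL_c br_hL_c wtL_c scale0r.
by rewrite hL_d br_hL_d wtL_d dsum_delta (d_deg _ gx) inGZ.
Qed.

Lemma toral_dim_gt0 : exists i : 'I_m, h i != 0.
Proof.
have [m0 [free _]] := D_toral HD; exists (Ordinal m0); apply/eqP => h0.
have : delta_mx 0 (Ordinal m0) = 0 :> 'rV[F]_m.
  apply: free; rewrite (bigD1 (Ordinal m0)) //= big1 => [|j ji].
    by rewrite h0 scaler0 addr0.
  by rewrite mxE (negPf ji) andbF scale0r.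
by move/rowP/(_ (Ordinal m0))/eqP; rewrite !mxE !eqxx oner_eq0.
Qed.

(** Each basis element of $\mathcal H$ maps $\mathcal L$ into $\mathcal G$, so $b_kX\in\mathcal G$
    with $b_k\ne0$ forces $X\in\mathcal G$; [gr_eigen] then makes the values on $D$ integral. *)
Lemma wspaceL_nz b X : X != 0 -> b != 0 -> wspace bL H b X ->
  exists a s x, [/\ b = wtL a s, X = inG x, x != 0, gr s x & ws a x].
Proof.
move: X => [[x c] u] X0 b0 wX.
have wh i : inG (br (h i) x) = b 0 (lshift _ i) *: ((x, c, u) : L).
  by rewrite -wX hL_h br_hL_h.
have wc i : b 0 (rshift m (lshift nu i)) = 0.
  apply/eqP; have := wX (rshift m (lshift nu i)); rewrite hL_c br_hL_c.
  by move/esym/eqP; rewrite scaler_eq0 (negPf X0) orbF.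
have wd i : inG (d i x) = b 0 (rshift m (rshift nu i)) *: ((x, c, u) : L).
  by rewrite -wX hL_d br_hL_d dsum_delta.
have [k bk] : exists k, b 0 k != 0 by apply/rV0Pn.
have [y Ey] : exists y, inG y = b 0 k *: ((x, c, u) : L).
  elim/forall_hL: k bk => i; first by exists (br (h i) x).
    by rewrite wc eqxx.
  by exists (d i x).
have c0 : c = 0.
  have /eqP := congr1 (fun X : L => X.1.2) Ey.
  by rewrite eq_sym scaler_eq0 (negPf bk) => /eqP.
have u0 : u = 0.
  have /eqP := congr1 (fun X : L => X.2) Ey.
  by rewrite eq_sym scaler_eq0 (negPf bk) => /eqP.
have x0 : x != 0 by apply: contraNneq X0 => x0; rewrite x0 c0 u0.
pose a := \row_i b 0 (lshift _ i).
have wx : ws a x by move=> i; rewrite mxE; have [] := wh i.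
have [s gx Es] : exists2 s, gr s x & (\row_i b 0 (rshift m (rshift nu i))) = map_mx intr s.
  apply: (gr_eigen hF HD (a := a) d_lin) => //; first by exists x.
  by move=> i; rewrite mxE; have [] := wd i.
exists a, s, x; split=> //; last by rewrite c0 u0.
apply/rowP; apply: forall_hL => i.
- by rewrite wtL_h mxE.
- by rewrite wtL_c wc.
by rewrite wtL_d; have /rowP/(_ i) := Es; rewrite !mxE.
Qed.

Lemma rootL_iff b : is_root bL H b <->
  exists a s x, [/\ b = wtL a s, x != 0, gr s x & ws a x].
Proof.
split=> [[X [X0 wX]]|[a [s [x [-> x0 gx wx]]]]].
  have [b0|b0] := eqVneq b 0.
    (* Zero weight vectors may involve $C$ and $D$, but a nonzero [h i] realizes the weight 0 inside
       $\mathcal G$. *)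
    have [i hi] := toral_dim_gt0; exists 0, 0, (h i); split=> //.
    - by rewrite wtL0.
    - exact: (gr_h HD).
    - exact: (ws_h HD).
  by have [a [s [x [Eb _ ? ? ?]]]] := wspaceL_nz X0 b0 wX; exists a, s, x.
exists (inG x); split; last exact: wspace_inG.
by move: x0; apply: contra_neq => E; have [->] := E.
Qed.

Lemma rootL_root a s : is_root bL H (wtL a s) -> root a.
Proof.
move=> /rootL_iff[a' [s' [x [/wtL_inj[-> _] x0 _ wx]]]]; by exists x.
Qed.

(** * The transferred form on the dual of H *)

(** Gram matrix of the dual isotropic pair $C$, $D$; it is its own inverse. *)
Definition gram_cd : 'M[F]_(nu + nu) := block_mx 0 1%:M 1%:M 0.

Lemma gramLE : gram fL H = block_mx (gram form h) 0 0 gram_cd.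
Proof.
apply/matrixP; apply: forall_hL => i; apply: forall_hL => j;
  rewrite [LHS]mxE ?hL_h ?hL_c ?hL_d /formL /= ?trmx0 ?mulmx0 ?mul0mx
    ?(form0l HD) ?(form0r HD) ?mulmx_tr_deltar /gram_cd
    ?(block_mxEul, block_mxEur, block_mxEdl, block_mxEdr) !mxE ?addr0 ?add0r //;
  by rewrite eq_sym.
Qed.

Lemma mulmx1_invmx k (A B : 'M[F]_k) : A *m B = 1%:M -> A \in unitmx /\ invmx A = B.
Proof.
move=> AB; have [uA _] := mulmx1_unit AB; split=> //.
by rewrite -[invmx A]mulmx1 -AB mulKmx.
Qed.

Lemma gramL_unit_inv : gram fL H \in unitmx /\
  invmx (gram fL H) = block_mx (invmx (gram form h)) 0 0 gram_cd.
Proof.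
apply: mulmx1_invmx; rewrite gramLE mulmx_block !mulmx0 !mul0mx !addr0 !add0r.
rewrite mulmxV ?(gram_unit HD) // /gram_cd mulmx_block !mulmx0 !mul0mx mulmx1.
by rewrite !addr0 !add0r -scalar_mx_block -scalar_mx_block.
Qed.

(** The inverse Gram matrix exchanges the coordinates of $C$ and $D$. Hence
    $t_{(a,s)}=t_a+\sum_is_ic_i$, and the form sees only [a]. *)
Lemma wt_invgramL (a : 'rV[F]_m) (s : 'rV[F]_nu) :
  row_mx a (row_mx 0 s) *m invmx (gram fL H) =
  row_mx (a *m invmx (gram form h)) (row_mx s 0).
Proof.
rewrite (proj2 gramL_unit_inv) mul_row_block !mulmx0 addr0 add0r /gram_cd.
by rewrite mul_row_block !mulmx0 mul0mx mulmx1 !add0r.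
Qed.

Lemma rformLE (a b : 'rV[F]_m) (s t : 'rV[F]_nu) :
  rform fL H (row_mx a (row_mx 0 s)) (row_mx b (row_mx 0 t)) = rf a b.
Proof.
rewrite /rform wt_invgramL !tr_row_mx !mul_row_col trmx0 mulmx0 mul0mx.
by rewrite addr0 mxE [X in _ + X]mxE addr0.
Qed.

Lemma sum_hL (c : 'rV[F]_m) (u v : 'rV[F]_nu) :
  \sum_k row_mx c (row_mx u v) 0 k *: H k = (\sum_i c 0 i *: h i, u, v).
Proof.
rewrite !big_split_ord /=.
under eq_bigr => i _ do rewrite row_mxEl hL_h.
under [X in _ + (X + _)]eq_bigr => i _ do rewrite row_mxEr row_mxEl hL_c.
under [X in _ + (_ + X)]eq_bigr => i _ do rewrite !row_mxEr hL_d.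
apply: LT_eq => /=.
- rewrite !(lin_sum (f := fun X : L => X.1.1)) //=.
  rewrite [X in _ + (X + _)]big1 => [|i _]; last exact: scaler0.
  by rewrite [X in _ + (_ + X)]big1 ?addr0 // => i _; apply: scaler0.
- rewrite !(lin_sum (f := fun X : L => X.1.2)) //= -row_sum_delta.
  rewrite big1 => [|i _]; last exact: scaler0.
  by rewrite [X in _ + (_ + X)]big1 ?addr0 ?add0r // => i _; apply: scaler0.
rewrite !(lin_sum (f := fun X : L => X.2)) //= -row_sum_delta.
rewrite big1 => [|i _]; last exact: scaler0.
by rewrite big1 ?add0r // => i _; apply: scaler0.
Qed.

Lemma tvecLE (a : 'rV[F]_m) (s : 'rV[F]_nu) :
  tvec fL H (row_mx a (row_mx 0 s)) = (tv a, s, 0).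
Proof. by rewrite /tvec wt_invgramL sum_hL. Qed.

(** Positive definiteness on the finite roots makes $(a,a)\ne0$ equivalent to $a\ne0$. *)
Lemma RxL b : Rx bL fL H b <->
  exists a s x, [/\ b = wtL a s, a != 0 /\ x != 0, gr s x & ws a x].
Proof.
rewrite /Rx rootL_iff; split=> [[[a [s [x [-> x0 gx wx]]]]]|[a [s [x [-> [a0 x0] gx wx]]]]].
  rewrite rformLE => a0; exists a, s, x; split=> //; split=> //.
  by apply: contraNneq a0 => ->; rewrite /rform !mul0mx mxE.
split; first by exists a, s, x.
by rewrite rformLE (rf_root_neq0 hF HD) //; exists x.
Qed.

Lemma R0L b : R0 bL fL H b <->
  exists s x, [/\ b = wtL 0 s, x != 0, gr s x & ws 0 x].
Proof.
rewrite /R0 rootL_iff; split=> [[[a [s [x [-> x0 gx wx]]]]]|[s [x [-> x0 gx wx]]]].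
  rewrite rformLE => q0; exists s, x.
  have [a0|a0] := eqVneq a 0; first by rewrite -a0.
  have ra : root a by exists x.
  by have := rf_root_neq0 hF HD ra a0; rewrite q0 eqxx.
split; first by exists 0, s, x.
by rewrite rformLE /rform !mul0mx mxE.
Qed.

(** * The nullity *)

Lemma LambdaL b : Lambda bL fL H b <-> exists2 s, zspan (supp gr) s & b = wtL 0 s.
Proof.
split=> [|[s Ss ->]].
  pose P b' := exists2 s, zspan (supp gr) s & b' = wtL 0 s.
  apply: (zspan_min (P := P)) => [|_ _ [s Ss ->] [t St ->]|u /R0L[s [x [-> x0 gx _]]]].
  - by exists 0; rewrite ?wtL0 //; exists [::]; rewrite big_nil.
  - exists (s - t); first exact: zspan_sub.
    by rewrite -wtLN wtLD oppr0 addr0.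
  by exists s => //; apply: zspan_gen; exists x.
pose P s' := Lambda bL fL H (wtL 0 s').
apply: (zspan_min (P := P) _ _ _ Ss) => [|u v Su Sv|]; rewrite /P;
  (* Every degree of the support occurs in the zero weight space, hence gives an isotropic root. *)
  last move=> u /(supp_zero_weight hF HD)[x [x0 gx wx]].
- by rewrite wtL0; exists [::]; rewrite big_nil.
- by rewrite -[0]subr0 -wtLD -[0](oppr0) wtLN; apply: zspan_sub => //; rewrite oppr0.
by apply: zspan_gen; apply/R0L; exists u, x.
Qed.

(** The span of the support has full rank, so it has a basis of $\nu$ elements, carried over by the
    injection $s\mapsto(0,s)$. *)
Lemma nullityL : nullity bL fL H nu.
Proof.
have [b0 [Sb0 ib0]] := supp_basis HD.
have [b [Sb [ib gen]]] : free_abelian_rank (zspan (supp gr)) nu.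
  apply: full_rank_sublattice_free Sb0 ib0; last exact: zspan_sub.
  by exists [::]; rewrite big_nil.
have wtL_sum z : wtL 0 (\sum_i b i *~ z i) = \sum_i wtL 0 (b i) *~ z i.
  apply/rowP; apply: forall_hL => i; rewrite summxE ?wtL_h ?wtL_c ?wtL_d.
  - by rewrite big1 ?mxE // => k _; rewrite -scaler_int mxE wtL_h mxE mulr0.
  - by rewrite big1 // => k _; rewrite -scaler_int mxE wtL_c mulr0.
  rewrite summxE rmorph_sum /=; apply: eq_bigr => k _.
  by rewrite -!scaler_int [X in X%:~R = _]mxE [RHS]mxE wtL_d intz rmorphM.
exists (fun i => wtL 0 (b i)); split; [|split].
- by move=> i; apply/LambdaL; exists (b i).
- move=> z; rewrite -wtL_sum -wtL0 => /wtL_inj[_ /ib]; exact.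
by move=> _ /LambdaL[s /gen[z ->] ->]; exists z.
Qed.

(** * The core, its centre and tameness *)

Lemma inG_lin a x y : inG (a *: x + y) = a *: inG x + inG y.
Proof. by apply: LT_eq => //=; rewrite scaler0 addr0. Qed.

Lemma LT_decomp (X : L) : X = inG X.1.1 + (0, X.1.2, X.2).
Proof. by apply: LT_eq => /=; rewrite ?addr0 ?add0r. Qed.

Lemma br_inG x y : bL (inG x) (inG y) = (br x y, \row_i form (d i x) y, 0).
Proof. by rewrite brLE /= !dsum0 subrr addr0. Qed.

(** The coefficient of $c_i$ is $(d_ix,y)=s_i(x,y)=s_i$ by [form_eq1]. *)
Lemma br_pair a s x y : a != 0 -> gr s x -> ws a x -> br x y = tv a ->
  bL (inG x) (inG y) = (tv a, map_mx intr s, 0).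
Proof.
move=> a0 gx wx xy; rewrite br_inG xy; apply: LT_eq => //=; apply/rowP => i.
by rewrite !mxE (d_deg _ gx) (formZl HD) (form_eq1 HD a0 wx xy) mulr1.
Qed.

Lemma wtL_eq0 a s : wtL a s = 0 -> a = 0.
Proof. by rewrite -wtL0 => /wtL_inj[]. Qed.

Lemma wspace_Rx b X : Rx bL fL H b -> wspace bL H b X -> X != 0 ->
  exists a s x, [/\ b = wtL a s, X = inG x, x != 0 /\ a != 0, gr s x & ws a x].
Proof.
move=> /RxL[a [s [x [-> [a0 _] _ _]]]] wX X0.
have [|a' [s' [x' [E -> x'0 gx' wx']]]] := wspaceL_nz X0 _ wX.
  by apply: contraNneq a0 => /wtL_eq0 ->.
exists a', s', x'; split=> //; split=> //.
by have [<- _] := wtL_inj E.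
Qed.

Section LcClosure.
Local Notation Lc' := (Lc bL fL H).

Lemma Lc_lin a X Y : Lc' X -> Lc' Y -> Lc' (a *: X + Y).
Proof.
move=> hX hY P sP gP; have [[_ PD] _] := sP.
by apply: PD; [apply: hX | apply: hY].
Qed.
Lemma Lc0 : Lc' 0. Proof. by move=> P [[]]. Qed.
Lemma Lc_add X Y : Lc' X -> Lc' Y -> Lc' (X + Y).
Proof. by move=> hX hY; rewrite -[X]scale1r; apply: Lc_lin. Qed.
Lemma Lc_sub X Y : Lc' X -> Lc' Y -> Lc' (X - Y).
Proof. by move=> hX hY; rewrite addrC -scaleN1r; apply: Lc_lin. Qed.
Lemma Lc_br X Y : Lc' X -> Lc' Y -> Lc' (bL X Y).
Proof.
move=> hX hY P sP gP; have [_ Pbr] := sP.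
by apply: Pbr; [apply: hX | apply: hY].
Qed.

Lemma Lc_gen a s x : root a -> a != 0 -> gr s x -> ws a x -> Lc' (inG x).
Proof.
move=> ra a0 gx wx; have [->|x0] := eqVneq x 0; first exact: Lc0.
move=> P _; apply; exists (wtL a s); split; last exact: wspace_inG.
by apply/RxL; exists a, s, x.
Qed.

Lemma Lc_pair a s x : root a -> a != 0 -> x != 0 -> gr s x -> ws a x ->
  Lc' (tv a, map_mx intr s, 0).
Proof.
move=> ra a0 x0 gx wx; have [y [gy wy xy]] := toral_pair HD ra a0 x0 gx wx.
rewrite -(br_pair a0 gx wx xy); apply: Lc_br; first exact: (Lc_gen ra a0 gx wx).
by apply: (Lc_gen (rootN hF HD ra) _ gy wy); rewrite oppr_eq0.
Qed.

Lemma Lc_c c : Lc' (0, c, 0).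
Proof.
have [b [Sb /(map_intr_unitmx hF)]] := supp_basis HD.
set B := map_mx _ _ => uB.
have Lb i : Lc' (0, map_mx intr (b i), 0).
  apply: (zspan_min (P := fun s => Lc' (0, map_mx intr s, 0)) _ _ _ (Sb i)).
  - by rewrite map_mx0; exact: Lc0.
  - move=> s t Ls Lt; rewrite map_mxB.
    have := Lc_sub Ls Lt; congr Lc'; by apply: LT_eq => //=; rewrite subrr.
  move=> s /(supp_zero_weight hF HD)[x [x0 gx wx]].
  have [a [t [y [z [ra a0 [y0 [gy wy]] [z0 [gz wz]]]]]]] := zero_weight_supp_diff hF HD x0 gx.
  (* Both elements have the same part $t_a$, so their difference is $\sum_is_ic_i$. *)
  have := Lc_sub (Lc_pair ra a0 z0 gz (wz wx)) (Lc_pair ra a0 y0 gy wy).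
  congr Lc'; apply: LT_eq => /=; rewrite ?subrr //.
  by rewrite map_mxD addrK.
(* The rows of [B] form a basis over [F], in which [c] is expanded. *)
rewrite -(mulmxKV uB c) mulmx_sum_row.
elim/big_ind: _ => [|u v Lu Lv|i _]; first exact: Lc0.
  have := Lc_add Lu Lv; congr Lc'; by apply: LT_eq => //=; rewrite addr0.
have := Lc_add (Lc_lin ((c *m invmx B) 0 i) (Lb i) Lc0) Lc0.
congr Lc'; apply: LT_eq => /=; rewrite ?scaler0 !addr0 //.
by rewrite /B -map_row rowK.
Qed.

Lemma LcP X : Lc' X <-> X.2 = 0.
Proof.
split=> [/(_ (fun Y : L => Y.2 = 0)) LX|X0].
  apply: LX => [|Y].
    split=> [|Y Z _ _]; last by rewrite brLE.
    by split=> // a Y Z Y0 Z0; rewrite [LHS]/= Y0 Z0 scaler0 addr0.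
  move=> [b [Rb wY]]; have [->//|Y0] := eqVneq Y 0.
  by have [a [s [x [_ -> _ _ _]]]] := wspace_Rx Rb wY Y0.
rewrite (LT_decomp X) X0; apply: Lc_add (Lc_c _).
elim/(nonzero_root_ind hF HD): (X.1.1) => [|x y Lx Ly|a s x ra a0 gx wx|].
- exact: Lc0.
- by rewrite (linD inG_lin); apply: Lc_add.
- exact: (Lc_gen ra a0 gx wx).
move=> a s t x y _ _ _ _ _ _ Lx Ly.
(* The bracket of $\mathcal G$ differs from that of $\mathcal L$ by an element of $C$, already known
   to lie in the core. *)
have := Lc_sub (Lc_br Lx Ly) (Lc_c (\row_i form (d i x) y)).
by congr Lc'; rewrite br_inG; apply: LT_eq => /=; rewrite ?subr0 ?subrr.
Qed.

Lemma centerP X : center_of bL Lc' X <-> X.1.1 = 0 /\ X.2 = 0.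
Proof.
split=> [[/LcP X0 cX]|[X1 X2]].
  split=> //; apply: (center_trivial hF HD) => a s y ra a0 gy wy.
  have := cX _ (Lc_gen ra a0 gy wy); rewrite brLE X0 /= !dsum0 subrr addr0.
  by case.
split; first exact/LcP.
by move=> Y _; move: X X1 X2 => [[x c] u] /= -> ->; apply: br_hL_c.
Qed.

Lemma tameL : tame bL fL H.
Proof.
move=> X cX; apply/LcP.
apply: (supp_separates hF HD) => s /(supp_zero_weight hF HD)[x [x0 gx wx]].
have [y [z [gy wy gz wz [yz fyz]]]] := zero_weight_pair HD x0 gx wx.
have := cX _ ((proj2 (LcP (inG y))) erefl); rewrite brLE /= !dsum0 subr0 => -[E _].
have dy : dsum X.2 y = (\sum_i X.2 0 i * (s 0 i)%:~R) *: y.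
  rewrite /dsum scaler_suml; apply: eq_bigr => i _.
  by rewrite (d_deg _ gy) scalerA.
(* Pairing with [z] kills the bracket term by invariance and $[y,z]=0$, leaving the scalar times
   $(y,z)=1$. *)
have := congr1 (fun u => form u z) E.
rewrite (formDl HD) (form_inv HD) yz (form0r HD) add0r dy (formZl HD) fyz mulr1.
by rewrite (form0l HD).
Qed.
End LcClosure.

(** * The axioms of the class T *)

Lemma br_hL_hL k l : bL (H k) (H l) = 0.
Proof.
elim/forall_hL: k => i; rewrite ?hL_h ?hL_c ?hL_d ?br_hL_h ?br_hL_c ?br_hL_d //;
  elim/forall_hL: l => j; rewrite ?hL_h ?hL_c ?hL_d /= ?(br0r Hlie) ?(lin0 (dsum_lin _)) //.
  by rewrite (ws_h HD j i) mxE scale0r.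
by rewrite dsum_delta d_h.
Qed.

Lemma toralL : fd_toral bL H.
Proof.
have [m0 [free _]] := D_toral HD.
split; first by rewrite ltn_addr.
split; [|split; [split; [split|]|]].
- move=> c; rewrite -[c]hsubmxK -[rsubmx c]hsubmxK sum_hL => -[/free E Ec Ed].
  by rewrite E Ec Ed !row_mx0.
- by exists 0; rewrite big1 // => i _; rewrite mxE scale0r.
- move=> a _ _ [c ->] [c' ->]; exists (a *: c + c').
  rewrite scaler_sumr -big_split; apply: eq_bigr => i _.
  by rewrite !mxE scalerDl scalerA.
- move=> _ _ [c ->] [c' ->]; exists 0.
  rewrite [RHS]big1 => [|k _]; last by rewrite mxE scale0r.
  rewrite (lin_sum (br_linl brL_lie _)) big1 // => k _.
  rewrite (brZl brL_lie) (lin_sum (br_linr brL_lie _)) big1 ?scaler0 // => l _.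
  by rewrite (brZr brL_lie) br_hL_hL scaler0.
move=> X.
have [l [El hl]] : exists l : seq ('rV[F]_(m + (nu + nu)) * L),
    inG X.1.1 = \sum_(p <- l) p.2 /\ forall p, p \in l -> wspace bL H p.1 p.2.
  elim/(bihom_ind HD): (X.1.1) => [|x y [l [El hl]] [l' [El' hl']]|a s x ra gx wx _].
  - by exists [::]; rewrite big_nil.
  - exists (l ++ l'); rewrite big_cat (linD inG_lin) El El'; split=> // p.
    by rewrite mem_cat => /orP[/hl|/hl'].
  exists [:: (wtL a s, inG x)]; rewrite big_seq1; split=> // p.
  by rewrite inE => /eqP ->; apply: wspace_inG.
(* The part in $C\oplus D$ commutes with $\mathcal H$ and enters as one vector of weight 0. *)
exists ((0, (0, X.1.2, X.2)) :: l); rewrite big_cons /= -El addrC -LT_decomp; split=> // p.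
rewrite inE => /orP[/eqP -> /=|/hl //]; apply: forall_hL => i.
- by rewrite hL_h br_hL_h (br0r Hlie) mxE scale0r.
- by rewrite hL_c br_hL_c mxE scale0r.
by rewrite hL_d br_hL_d (lin0 (dsum_lin _)) mxE scale0r.
Qed.

Lemma wtLMn a s k : wtL a s *+ k = wtL (a *+ k) (s *+ k).
Proof. by elim: k => [|k IH]; rewrite ?mulr0n ?wtL0 // !mulrS IH wtLD. Qed.

(** On a weight vector, iterates that never vanish would give the infinite string $a'+ka$ of finite
    roots; for sums the exponents add. *)
Lemma brL_locally_nilpotent b X Y : Rx bL fL H b -> wspace bL H b X ->
  exists k, iter k (bL X) Y = 0.
Proof.
move=> Rb wX; have [->|X0] := eqVneq X 0.
  by exists 1; rewrite /= (br0l brL_lie).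
have [a [s [x [Eb _ [_ a0] _ _]]]] := wspace_Rx Rb wX X0.
have [_ [_ [_ /(_ Y)[l [-> hl]]]]] := toralL.
have iter_lin k c (U V : L) : iter k (bL X) (c *: U + V) =
    c *: iter k (bL X) U + iter k (bL X) V.
  by elim: k => //= k ->; rewrite (br_linr brL_lie).
have iter_ge k j U : iter k (bL X) U = 0 -> iter (j + k) (bL X) U = 0.
  by rewrite iterD => ->; rewrite (lin0 (iter_lin j)).
rewrite big_seq; elim/big_ind: _ => [|U V [i Ui] [j Vj]|p /hl wp].
- by exists 0%N.
- exists (i + j)%N; rewrite (linD (iter_lin _)) [X in _ + X]iter_ge // addr0.
  by rewrite addnC iter_ge.
apply: NNPP => none.
have rk k : is_root bL H (p.1 + b *+ k).
  exists (iter k (bL X) p.2); split; last exact: (wspace_iter brL_lie k wX wp).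
  by apply/eqP => E; apply: none; exists k.
have /rootL_iff[a' [s' [_ [E _ _ _]]]] : is_root bL H p.1.
  by have := rk 0%N; rewrite mulr0n addr0.
apply: (@no_infinite_string _ hF _ _ _ _ _ _ _ HD a a' a0) => k.
by apply: (@rootL_root _ (s' + s *+ k)); rewrite -wtLD -wtLMn -E -Eb.
Qed.

Lemma RxL_irreducible : ~ exists P Q : 'rV[F]_(m + (nu + nu)) -> Prop,
  (forall a, Rx bL fL H a <-> (P a \/ Q a)) /\ (forall a, ~ (P a /\ Q a)) /\
  (exists a, P a) /\ (exists a, Q a) /\
  (forall a b, P a -> Q b -> rform fL H a b = 0).
Proof.
move=> [P [Q [PQ [dPQ [[p Pp] [[q Qq] orth]]]]]].
have [[_ _ _ _ rs] _] := HD; have [_ _ _ _] := rs; apply.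
(* A partition of the non-isotropic roots projects to one of the nonzero finite roots, since the
   form depends only on the finite part. *)
pose pr (S : 'rV[F]_(m + (nu + nu)) -> Prop) a := exists s, S (wtL a s).
have Rx_wt S b : (forall a, S a -> Rx bL fL H a) -> S b -> exists a, pr S a.
  by move=> SR Sb; have /RxL[a [s [_ [E _ _ _]]]] := SR _ Sb; exists a, s; rewrite -E.
have RP a : P a -> Rx bL fL H a by move=> Pa; apply/PQ; left.
have RQ a : Q a -> Rx bL fL H a by move=> Qa; apply/PQ; right.
have Rx_root a s : Rx bL fL H (wtL a s) -> root a /\ a != 0.
  by move=> /RxL[a' [s' [x [/wtL_inj[-> _] [a0 x0] _ wx]]]]; split=> //; exists x.
have po a b : pr P a -> pr Q b -> rf a b = 0.
  move=> [s Ps] [t Qt]; rewrite -(rformLE _ _ (map_mx intr s) (map_mx intr t)).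
  exact: orth.
exists (pr P), (pr Q); split; [|split; [|split; [|split]]].
- move=> a; split=> [[ra a0]|[[s /RP]|[s /RQ]]]; try exact: Rx_root.
  have [s [x [x0 gx wx]]] := ws_bihom HD ra.
  have : Rx bL fL H (wtL a s) by apply/RxL; exists a, s, x.
  by move=> /PQ[Pa|Qa]; [left | right]; exists s.
(* A finite root in both projections would be orthogonal to itself. *)
- move=> a [Pa Qa]; have [s /RP/Rx_root[ra a0]] := Pa.
  by have := rf_root_neq0 hF HD ra a0; rewrite po ?eqxx.
- exact: Rx_wt RP Pp.
- exact: Rx_wt RQ Qq.
exact: po.
Qed.

Lemma brL_in_T : in_T bL fL H.
Proof.
split.
- split; first exact: brL_lie.
  split; first exact: formL_sym.
  by split; [apply: formL_inv | apply: formL_nondeg].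
- by split; [apply: toralL | have [] := gramL_unit_inv].
- split=> [_ /R0L[s [x [-> x0 gx wx]]]|b Rb X wX X0].
    (* The commuting pair with $(y,z)=1$ has $[y,z]'=\sum_is_ic_i=t_{(0,s)}$. *)
    have [y [z [gy wy gz wz [yz fyz]]]] := zero_weight_pair HD x0 gx wx.
    exists (inG y), (inG z); split; first exact: wspace_inG.
    split; first by rewrite -wtLN oppr0; apply: wspace_inG.
    rewrite br_inG yz tvecLE; apply: LT_eq => //=.
      by rewrite /tvec big1 // => i _; rewrite mul0mx mxE scale0r.
    by apply/rowP => i; rewrite !mxE (d_deg _ gy) (formZl HD) fyz mulr1.
  have [a [s [x [-> -> [x0 a0] gx wx]]]] := wspace_Rx Rb wX X0.
  have [|y [gy wy xy]] := toral_pair HD _ a0 x0 gx wx; first by exists x.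
  exists (inG y); split; first by rewrite -wtLN; apply: wspace_inG.
  by rewrite (br_pair a0 gx wx xy) tvecLE.
- split; first by move=> b X Rb wX Y; apply: brL_locally_nilpotent Rb wX.
  split; first exact: RxL_irreducible.
  move=> _ /R0L[s [x [-> x0 gx wx]]].
  have [a [t [y [z [ra a0 [y0 [gy wy]] [z0 [gz wz]]]]]]] := zero_weight_supp_diff hF HD x0 gx.
  exists (wtL a t); split; first by apply/RxL; exists a, t, y.
  apply/rootL_iff; exists a, (s + t), z; split=> //; last exact: wz.
  by rewrite wtLD addr0 addrC.
by exists nu; apply: nullityL.
Qed.

(** * The type of L *)

Lemma qspan_rootL u : qspan (is_root bL H) u ->
  qspan root (lsubmx u) /\ exists s, u = row_mx (lsubmx u) (row_mx 0 s).
Proof.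
move=> [l [-> hl]]; set u' := \sum_(p <- l) _.
have hl' p : p \in l -> exists a s, p.2 = wtL a s /\ root a.
  move=> /hl rp; have /rootL_iff[a [s [x [E x0 _ wx]]]] := rp.
  by exists a, s; split=> //; exists x.
split.
  exists [seq (p.1, lsubmx p.2) | p : rat * 'rV[F]_(m + (nu + nu)) <- l]; split.
    rewrite big_map /u' linear_sum; apply: eq_bigr => p _; exact: linearZ.
  by move=> q /mapP[p /hl'[a [s [E ra]]] ->] /=; rewrite E row_mxKl.
exists (rsubmx (rsubmx u')); rewrite -[LHS]hsubmxK -[rsubmx u' in LHS]hsubmxK.
congr (row_mx _ (row_mx _ _)).
rewrite /u' !linear_sum big_seq big1 // => p /hl'[a [s [-> _]]].
by rewrite !linearZ /= row_mxKr row_mxKl scaler0.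
Qed.

Lemma same_typeL : same_type bL fL H root.
Proof.
(* Restriction to $\dot{\mathfrak h}$ is the quotient map: definiteness identifies its kernel with
   the radical. *)
exists lsubmx; split; [|split; [|split]].
- by move=> q u v _ _; rewrite linearP.
- move=> u /qspan_rootL[qu [s Eu]]; split=> [u0 b|orth].
    move=> /rootL_iff[a [t [_ [-> _ _ _]]]].
    by rewrite Eu u0 rformLE /rform !mul0mx mxE.
  have orth_root a : root a -> rf (lsubmx u) a = 0.
    move=> ra; have [t [x [x0 gx wx]]] := ws_bihom HD ra.
    rewrite -(rformLE _ _ s (map_mx intr t)) -Eu; apply: orth.
    by apply/rootL_iff; exists a, t, x.
  (* The restriction is a rational combination of roots orthogonal to it, hence isotropic, hence
     zero. *)
  apply/eqP/negPn/negP => /(rf_qspan_neq0 hF HD qu)/eqP; apply.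
  have [l [E hl]] := qu; rewrite [X in rf _ X]E.
  have rD c a b : rf (lsubmx u) (c *: a + b) =
      c *: (rf (lsubmx u) a : F^o) + rf (lsubmx u) b :> F^o.
    by rewrite /rform linearP /= mulmxDr -scalemxAr mxE [X in X + _]mxE.
  rewrite (lin_sum rD) big_seq big1 // => p /hl rp.
  by rewrite (linZ rD) orth_root ?scaler0.
- by move=> _ /rootL_iff[a [s [x [-> x0 _ wx]]]]; rewrite row_mxKl; exists x.
move=> a ra; have [s [x [x0 gx wx]]] := ws_bihom HD ra.
exists (wtL a s); rewrite row_mxKl; split=> //.
by apply/rootL_iff; exists a, s, x.
Qed.

End Extension.

Theorem theorem2p17 (F : fieldType) (hF : [pchar F] =i pred0)
  (G : lmodType F) (br : G -> G -> G) (form : G -> G -> F)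
  (m : nat) (h : 'I_m -> G) (nu : nat) (hnu : (1 <= nu)%N)
  (gr : 'rV[int]_nu -> G -> Prop)
  (HD : in_D br form h gr)
  (d : 'I_nu -> G -> G)
  (d_lin : forall i a x y, d i (a *: x + y) = a *: d i x + d i y)
  (d_deg : forall i s x, gr s x -> d i x = (s 0 i)%:~R *: x) :
  let L := LT G nu in
  let brL' := brL br form d in
  let formL' := @formL F G form nu in
  let H := @hL F G nu m h in
  [/\ (forall i, is_derivation br (d i)) /\
      (forall a : 'rV[F]_nu, (forall x, \sum_i a 0 i *: d i x = 0) -> a = 0),
      is_lie_algebra brL' /\
      in_T brL' formL' H,
      tame brL' formL' H /\ nullity brL' formL' H nu /\
      same_type brL' formL' H (Rd br h),
      (forall X : L, Lc brL' formL' H X <-> X.2 = 0) /\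
      (forall X : L, center_of brL' (Lc brL' formL' H) X <-> (X.1.1 = 0 /\ X.2 = 0)) &
      exists phi : L -> G,
        [/\ forall a X Y, phi (a *: X + Y) = a *: phi X + phi Y,
            forall X Y, Lc brL' formL' H X -> Lc brL' formL' H Y ->
              phi (brL' X Y) = br (phi X) (phi Y),
            forall x, exists X, Lc brL' formL' H X /\ phi X = x &
            forall X, Lc brL' formL' H X ->
              (phi X = 0 <-> center_of brL' (Lc brL' formL' H) X)] ].
Proof.
move=> L brL' formL' H.
have LcE := LcP hF HD d_lin d_deg; have ZE := centerP hF HD d_lin d_deg.
split.
- split=> [i|a a0]; first exact: (d_derivation HD d_lin d_deg).
  exact: (dsum_eq0 hF HD d_deg a0).
- by split; [apply: (brL_lie hF HD) | apply: (brL_in_T hF HD)].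
- split; first exact: (tameL hF HD).
  by split; [apply: (nullityL hF HD) | apply: (same_typeL hF HD)].
- by split.
(* The projection to $\mathcal G$ loses exactly $C$ on the core, which is the centre. *)
exists (fun X => X.1.1); split=> //.
- by move=> X Y /LcE X0 /LcE Y0; rewrite /brL' brLE X0 Y0 /= !dsum0 subrr addr0.
- by move=> x; exists (inG nu x); split=> //; apply/LcE.
by move=> X /LcE X0; rewrite ZE; split=> [|[]].
Qed.
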